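(* Let $h(z)=\sum_{k=0}^{\infty}a_k z^k$ be an analytic function on $|z|<r$ whose Taylor series about $0$ has radius of convergence $r$. Let $f$ be a positive function in the Wiener class on $[-\pi,\pi]$ such that $\frac{f_{\max}^2}{f_{\min}}<r$. For each $n\ge 1$ let $A_n\in\mathbb{C}^{n\times n}$ be the Toeplitz matrix generated by $f$ and let $T_n\in\mathbb{C}^{n\times n}$ be the superoptimal circulant preconditioner for $A_n$. If $\|h(T_n)^{-1}\|_2$ is uniformly bounded with respect to $n$, then $|h(T_n)|^{-1}h(A_n)$ has clustered spectrum around $\pm1$ for sufficiently large $n$; that is, for any $\epsilon>0$ there exist positive integers $M$ and $N$ such that for all $n>N$ at most $M$ eigenvalues $\lambda$ of $|h(T_n)|^{-1}h(A_n)$ satisfy both $|\lambda-1|>\epsilon$ and $|\lambda+1|>\epsilon$.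
   Context: The Fourier coefficients of $f$ on $[-\pi,\pi]$ (extended $2\pi$-periodically) are $\hat f_k=\frac{1}{2\pi}\int_{-\pi}^{\pi}f(x)e^{-\mathbf{i}kx}\,dx$, $k\in\mathbb{Z}$. The function $f$ is in the Wiener class if $\sum_{k\in\mathbb{Z}}|\hat f_k|<\infty$ (so $f$ is continuous and equals the sum of its Fourier series). ''Positive'' means real-valued with $f(x)>0$ for all $x$; $f_{\max}$ and $f_{\min}$ are the maximum and minimum of $f$. The Toeplitz matrix generated by $f$ is $A_n=[\hat f_{j-k}]_{j,k=0}^{n-1}$; it is Hermitian positive definite for all $n$. The Fourier matrix $U_n\in\mathbb{C}^{n\times n}$ has entries $[U_n]_{jk}=\frac{1}{\sqrt n}e^{-2\pi\mathbf{i}jk/n}$, $0\le j,k\le n-1$. The set of circulant matrices is $\mathcal{M}_{U_n}=\{U_n^*\Lambda_nU_n : \Lambda_n \text{ an } n\times n \text{ complex diagonal matrix}\}$. The superoptimal circulant preconditioner $T_n$ for $A_n$ is the minimizer of $\|I_n-C_n^{-1}A_n\|_F$ over all nonsingular $C_n\in\mathcal{M}_{U_n}$, where $\|\cdot\|_F$ is the Frobenius norm. Matrix functions are defined by the power series: $h(X)=\sum_{k=0}^\infty a_kX^k$ for a matrix $X$ of spectral radius less than $r$; here $r\in(0,\infty]$. For a circulant $C_n=U_n^*\Omega_nU_n$ ($\Omega_n$ diagonal), the absolute value circulant matrix is $|C_n|=(C_n^*C_n)^{1/2}=U_n^*|\Omega_n|U_n$, where $|\Omega_n|$ is $\Omega_n$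 with every entry replaced by its modulus; thus $|h(T_n)|=U_n^*|h(\Lambda_n)|U_n$ when $T_n=U_n^*\Lambda_nU_n$. $\|\cdot\|_2$ is the spectral norm. Uniform boundedness of $\|h(T_n)^{-1}\|_2$ means $h(T_n)$ is nonsingular for every $n$ and there is a constant $c_0$ independent of $n$ with $\|h(T_n)^{-1}\|_2<c_0$. Eigenvalues are counted with multiplicity.
   Formalization: The Taylor coefficients a_k of h are assumed to be real; for complex coefficients the claim fails, e.g. h(z)=i and f=1 give |h(T_n)|^{-1}h(A_n)=iI_n, with all eigenvalues at distance √2 from ±1. *)

(* Defs.v *)
From HB Require Import structures.
From mathcomp Require Import all_boot all_order all_algebra.
From mathcomp Require Import complex ring lra.
From mathcomp Require Import all_classical all_reals all_analysis.

Set Implicit Arguments.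
Unset Strict Implicit.
Unset Printing Implicit Defensive.

Import Order.TTheory GRing.Theory Num.Theory.
Import numFieldNormedType.Exports.

Local Open Scope classical_set_scope.
Local Open Scope ring_scope.
Local Open Scope complex_scope.
Local Open Scope sesquilinear_scope.

Section Modulus.
Variable R : rcfType.

(* [`|z|] lives in [R[i]]; this is the same modulus as an element of [R]. *)
Definition modulus (z : R[i]) : R := complex.Re `|z|.

Lemma modulusE (z : R[i]) : (modulus z)%:C = `|z|.
Proof. by rewrite /modulus normc_def. Qed.

End Modulus.

Section Fourier.
Variable R : realType.

Definition expi (x : R) : R[i] := cos x +i* sin x.

Definition cintegral (D : set R) (F : R -> R[i]) : R[i] :=
  (\int[lebesgue_measure]_(x in D) complex.Re (F x))%R +i*
  (\int[lebesgue_measure]_(x in D) complex.Im (F x))%R.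

Definition fourier_coef (f : R -> R) (k : int) : R[i] :=
  ((2 * pi)^-1)%:C *
  cintegral `[- pi, pi] (fun x => (f x)%:C * expi (- (k%:~R * x))).

(* [f] stands for its own 2pi-periodic extension to the whole line. *)
Definition wiener (f : R -> R) : Prop :=
  [/\ periodic f (2 * pi), continuous f &
      summable [set: int] (fun k => (modulus (fourier_coef f k))%:E)].

Definition fmax (f : R -> R) : R := sup (f @` `[- pi, pi]).
Definition fmin (f : R -> R) : R := inf (f @` `[- pi, pi]).

Definition toeplitz (f : R -> R) (n : nat) : 'M[R[i]]_n :=
  \matrix_(j, k) fourier_coef f (Posz j - Posz k).

End Fourier.

Section Matrices.
Variable R : realType.

Definition frobenius_norm m n (A : 'M[R[i]]_(m, n)) : R :=
  Num.sqrt (\sum_i \sum_j modulus (A i j) ^+ 2).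

(* The Frobenius norm of a column vector is its Euclidean norm. *)
Definition spectral_norm m n (A : 'M[R[i]]_(m, n)) : R :=
  sup [set frobenius_norm (A *m x) |
        x in [set x : 'cV[R[i]]_n | frobenius_norm x <= 1]].

(* The roots of the characteristic polynomial, each repeated according to its
   algebraic multiplicity; the order is arbitrary. *)
Definition eigenvalues n (A : 'M[R[i]]_n) : seq R[i] :=
  sval (closed_field_poly_normal (char_poly A)).

Lemma eigenvaluesP n (A : 'M[R[i]]_n) :
  char_poly A = \prod_(z <- eigenvalues A) ('X - z%:P).
Proof.
rewrite /eigenvalues; case: closed_field_poly_normal => s /= {1}->.
by rewrite (monicP (char_poly_monic A)) scale1r.
Qed.

Definition fourier_mx (n : nat) : 'M[R[i]]_n :=
  \matrix_(j, k)
    (((Num.sqrt n%:R)^-1)%:C * expi (- (2 * pi * (j * k)%:R / n%:R))).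

Definition circulant_of n (w : 'rV[R[i]]_n) : 'M[R[i]]_n :=
  (fourier_mx n)^t* *m diag_mx w *m fourier_mx n.

Definition circulant n (C : 'M[R[i]]_n) : Prop :=
  exists w : 'rV[R[i]]_n, C = circulant_of w.

Definition superoptimal n (A T : 'M[R[i]]_n) : Prop :=
  [/\ circulant T, T \in unitmx &
      forall C : 'M[R[i]]_n, circulant C -> C \in unitmx ->
        frobenius_norm (1%:M - invmx T *m A) <=
        frobenius_norm (1%:M - invmx C *m A)].

(* When [C = U^* diag(w) U] with [U] the (unitary) Fourier matrix, [w] is the
   diagonal of [U C U^*]; see [circulant_absE]. *)
Definition circulant_abs n (C : 'M[R[i]]_n) : 'M[R[i]]_n :=
  circulant_of (\row_i `|(fourier_mx n *m C *m (fourier_mx n)^t*) i i|).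

End Matrices.

Section FourierMatrix.
Variable R : realType.
Implicit Types x y : R.

Lemma expiD x y : expi (x + y) = expi x * expi y.
Proof.
rewrite /expi cosD sinD; apply/eqP; rewrite eq_complex /=.
by apply/andP; split; apply/eqP => //; ring.
Qed.

Lemma expi0 : expi 0 = 1 :> R[i].
Proof. by rewrite /expi cos0 sin0. Qed.

Lemma expiMn x (k : nat) : expi (x *+ k) = expi x ^+ k.
Proof.
by elim: k => [|k IH]; rewrite ?mulr0n ?expi0 ?expr0 // mulrS expiD IH exprS.
Qed.

Lemma conj_expi x : Num.conj (expi x) = expi (- x).
Proof. by rewrite /expi cosN sinN. Qed.

Lemma expi_2pi (k : nat) : expi (2 * pi *+ k) = 1 :> R[i].
Proof.
rewrite expiMn mulr_natl /expi.
by rewrite -[pi *+ 2]add0r sinD2pi cosD2pi sin0 cos0 expr1n.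
Qed.

Lemma expi_neq1 x : 0 < x < 2 * pi -> expi x != 1.
Proof.
move=> /andP[x0 x2]; apply/negP => /eqP[cx _].
have s0 : 0 < sin (x / 2).
  by apply: sin_gt0_pi; rewrite divr_gt0 //= ltr_pdivrMr // mulrC.
have xE : x = (x / 2) *+ 2 by rewrite -mulr_natr divfK.
have := exprn_gt0 2 s0; rewrite sin2cos2.
by move: cx; rewrite {1}xE cos_mulr2n; lra.
Qed.

Lemma fourier_mx_unitary n : fourier_mx R n \is unitarymx.
Proof.
apply/unitarymxP/matrixP => j l; rewrite !mxE.
have n0 : (0 < n)%N by case: n j l => [[]|].
have nR0 : 0 < n%:R :> R by rewrite ltr0n.
pose t : R := 2 * pi / n%:R.
have tn : t *+ n = 2 * pi by rewrite -[LHS]mulr_natr /t divfK // gt_eqF.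
have t0 : 0 < t by rewrite divr_gt0 // mulr_gt0 // pi_gt0.
pose z : R[i] := expi (t *+ l - t *+ j).
have c2 : ((Num.sqrt (n%:R : R))^-1)%:C ^+ 2 = (n%:R)^-1 :> R[i].
  by rewrite -rmorphXn exprVn sqr_sqrtr ?ler0n // fmorphV rmorph_nat.
have conjM (u v : R[i]) : Num.conj (u * v) = Num.conj u * Num.conj v.
  exact: rmorphM.
have -> : \sum_k fourier_mx R n j k * ((fourier_mx R n)^t* ) k l =
          (n%:R)^-1 * \sum_(k < n) z ^+ k.
  rewrite mulr_sumr; apply: eq_bigr => k _; rewrite !mxE -c2 conjM conj_expi.
  have -> : Num.conj ((Num.sqrt n%:R)^-1)%:C = ((Num.sqrt n%:R)^-1)%:C :> R[i].
    exact: conjc_real.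
  rewrite /z -expiMn mulrACA -expr2 -expiD; congr (_ * expi _).
  rewrite opprK addrC mulrnBl -!mulrnA -[t *+ (l * k)]mulr_natr.
  by rewrite -[t *+ (j * k)]mulr_natr /t ![_ * _ / n%:R]mulrAC.
have [jl|jl] := eqVneq j l.
  rewrite /z jl subrr expi0; under eq_bigr do rewrite expr1n.
  by rewrite sumr_const card_ord mulVf // pnatr_eq0 -lt0n.
have neq1 (p q : nat) : (p < q < n)%N -> expi (t *+ q - t *+ p) != 1.
  move=> /andP[pq qn]; apply: expi_neq1; rewrite subr_gt0 -tn ltr_pMn2l // pq.
  rewrite ltrBlDr (@lt_le_trans _ _ (t *+ n)) ?ltr_pMn2l //.
  by rewrite lerDl mulrn_wge0 // ltW.
have z1 : z != 1.
  case: (ltngtP j l) => [lt_jl|lt_lj|/val_inj/eqP]; last by rewrite (negPf jl).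
    by rewrite neq1 // lt_jl ltn_ord.
  apply: contra (neq1 l j _); last by rewrite lt_lj ltn_ord.
  by move=> /eqP z1; rewrite -opprB -conj_expi -/z z1 conjC1.
suff /eqP : (z - 1) * \sum_(k < n) z ^+ k = 0.
  by rewrite mulf_eq0 subr_eq0 (negPf z1) /= => /eqP ->; rewrite mulr0.
rewrite -subrX1 /z -expiMn mulrnBl -!mulrnA ![(_ * n)%N]mulnC !mulrnA tn.
by rewrite expiD -conj_expi !expi_2pi conjC1 mulr1 subrr.
Qed.

Lemma mulmx_fourierC n : (fourier_mx R n)^t* *m fourier_mx R n = 1%:M.
Proof.
exact/mulmx1C/unitarymxP/fourier_mx_unitary.
Qed.

Lemma circulant_ofK n (w : 'rV[R[i]]_n) :
  fourier_mx R n *m circulant_of w *m (fourier_mx R n)^t* = diag_mx w.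
Proof.
have /unitarymxP UU := fourier_mx_unitary n.
by rewrite /circulant_of !mulmxA UU mul1mx -mulmxA UU mulmx1.
Qed.

Lemma circulant_absE n (w : 'rV[R[i]]_n) :
  circulant_abs (circulant_of w) = circulant_of (map_mx Num.norm w).
Proof.
rewrite /circulant_abs circulant_ofK; congr circulant_of.
by apply/rowP => i; rewrite !mxE eqxx mulr1n.
Qed.

Lemma circulant_of_mul n (v w : 'rV[R[i]]_n) :
  circulant_of v *m circulant_of w = circulant_of (\row_i (v 0 i * w 0 i)).
Proof.
have /unitarymxP UU := fourier_mx_unitary n.
rewrite /circulant_of !mulmxA -[_ *m _ *m (fourier_mx R n)^t*]mulmxA UU mulmx1.
rewrite -[_ *m diag_mx v *m _]mulmxA mulmx_diag; congr (_ *m diag_mx _ *m _).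
Qed.

Lemma circulant_of_adj n (w : 'rV[R[i]]_n) :
  (circulant_of w)^t* = circulant_of (map_mx Num.conj w).
Proof.
by rewrite /circulant_of !trmx_mul !map_mxM tr_diag_mx map_diag_mx trmxCK mulmxA.
Qed.

(* [circulant_abs C] is the square root of [C^* C] that is unitarily similar
   to a nonnegative diagonal matrix. *)
Lemma circulant_abs_sqr n (C : 'M[R[i]]_n) : circulant C ->
  circulant_abs C *m circulant_abs C = C^t* *m C.
Proof.
move=> [w ->]; rewrite circulant_absE circulant_of_adj !circulant_of_mul.
congr circulant_of; apply/rowP => i; rewrite !mxE.
by rewrite -expr2 normCK mulrC.
Qed.

End FourierMatrix.

Section PowerSeries.
Variable R : realType.

Definition conv_radius (a : nat -> R[i]) : \bar R :=
  ereal_sup [set (modulus z)%:E |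
    z in [set z : R[i] | cvgn (series (fun k => a k * z ^+ k : R[i]^o))]].

Definition matrix_fun (a : nat -> R[i]) n (X : 'M[R[i]]_n) : 'M[R[i]]_n :=
  \matrix_(i, j) limn (series (fun k => a k * (X ^+ k) i j : R[i]^o)).

End PowerSeries.

(* Main.v *)
Require Import Defs.
From HB Require Import structures.
From mathcomp Require Import all_boot all_order all_algebra.
From mathcomp Require Import complex zify ring lra.
From mathcomp Require Import all_classical all_reals all_analysis.

(** Let [A_n] be the Toeplitz matrix of [f], [T_n] its superoptimal circulant,
    [U_n] the Fourier matrix and [B_n = U_n A_n U_n^*].

    Call a family of matrices [X_n] clustered at zero ([zero_clustered]) when, for
    every positive [eps], all but finitely many [X_n] are the sum of a matrix of rank at most
    [k] (with [k] depending on [eps] only) and of a matrix of operator norm at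
    most [eps].  Such families are stable under sums, under products with
    uniformly bounded families and under uniform approximation.  As
    [A^k.+1 - T^k.+1 = A^k (A - T) + (A^k - T^k) T], if [A_n - T_n] is clustered
    at zero then so are the differences of powers, hence those of partial sums
    of [h], hence [h(A_n) - h(T_n)]: the spectra of [A_n] and of [T_n] lie in
    [[0, fmax]], and [fmax <= fmax^2 / fmin < r], so that the tails of the power
    series are uniformly small ([matrix_fun_clustered]).

    That [A_n - T_n] is clustered at zero ([toeplitz_superopt_clustered]) is
    seen by comparing both with the circulant [C_n] whose eigenvalues [d_i] are
    the values, at the n-th roots of unity, of the Fourier series of [f] cut at
    frequency [m].  Off the first and last [m] rows, [A_n] and [C_n] differ by
    the Toeplitz matrix of the coefficients of frequency above [m], whose norm
    is at most their absolute sum; the remaining [2m] rows have rank at most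
    [2m] ([strang_split]).  On the other side, minimizing
    [|1 - C^-1 A_n|] over circulants is one scalar problem for each row of
    [B_n], and [T_n] has eigenvalues [|row i B_n|^2 / B_n i i]
    ([superoptimal_diag]).  The entries of [U_n] have modulus [n^(-1/2)], so the
    part of a row of [U_n] on the [2m] corner coordinates has a norm tending to
    zero; therefore row [i] of [B_n] is close to [d_i e_i], and the i-th
    eigenvalue of [T_n] is close to [d_i] uniformly in [i]
    ([lambda_near_grid]).

    Finally let [Q = |h(T_n)|^(-1/2)], which is bounded uniformly in [n].  The
    matrix [|h(T_n)|^-1 h(A_n)] is similar to the Hermitian matrix
    [H = Q h(A_n) Q], while [S = Q h(T_n) Q] is unitary, and [H = S + L + E]
    with [L] of bounded rank and [E] small.  In a spectral subspace of [H] of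
    dimension larger than the rank of [L] there is a nonzero vector killed by
    [L], whose norm [H] multiplies by a factor close to [1].  Hence only boundedly
    many eigenvalues of [H] have modulus at most [1 - eps] or at least [1 + eps]
    ([count_near_unitary]), and the others, being real, are within [eps] of [1]
    or of [-1]. *)

Set Implicit Arguments.
Unset Strict Implicit.
Unset Printing Implicit Defensive.

Import Order.TTheory GRing.Theory Num.Theory.
Import numFieldNormedType.Exports.

Local Open Scope ring_scope.
Local Open Scope complex_scope.
Local Open Scope sesquilinear_scope.

(** * Norms of row vectors, operator bounds and unitary diagonalization *)

Section RowNorm.
Variable C : numClosedFieldType.

(** Rows are acted on from the right, in agreement with the row-space
    convention for ranks and kernels. *)
Definition nrm n (u : 'rV[C]_n) : C := sqrtC (dotmx u u).

Lemma nrm_ge0 n (u : 'rV[C]_n) : 0 <= nrm u.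
Proof. exact: sqrt_dnorm_ge0. Qed.

Lemma nrm_gt0 n (u : 'rV[C]_n) : (0 < nrm u) = (u != 0).
Proof. exact: sqrt_dnorm_gt0. Qed.

Lemma sqr_nrm n (u : 'rV[C]_n) : nrm u ^+ 2 = \sum_i `|u 0 i| ^+ 2.
Proof.
rewrite sqrtCK dotmxE mxE; apply: eq_bigr => i _.
by rewrite !mxE normCK.
Qed.

Lemma ler_nrm m n (u : 'rV[C]_m) (v : 'rV[C]_n) c : 0 <= c ->
  nrm u ^+ 2 <= c ^+ 2 * nrm v ^+ 2 -> nrm u <= c * nrm v.
Proof.
move=> c0; rewrite -exprMn ler_sqr // nnegrE ?mulr_ge0 ?nrm_ge0 //.
Qed.

Lemma ler_nrmD n (u v : 'rV[C]_n) : nrm (u + v) <= nrm u + nrm v.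
Proof. exact: (triangle_lerif (@dotmx C n) u v).1. Qed.

Lemma nrmZ n a (u : 'rV[C]_n) : nrm (a *: u) = `|a| * nrm u.
Proof.
by rewrite /nrm dnormZ sqrtCM ?nnegrE ?exprn_ge0 ?dnorm_ge0 // sqrCK.
Qed.

Lemma nrmN n (u : 'rV[C]_n) : nrm (- u) = nrm u.
Proof. by rewrite -scaleN1r nrmZ normrN1 mul1r. Qed.

Lemma ler_nrmB n (u v : 'rV[C]_n) : nrm (u - v) <= nrm u + nrm v.
Proof. by rewrite -(nrmN v) ler_nrmD. Qed.

Lemma nrm_unitary m n (V : 'M[C]_(m, n)) (u : 'rV[C]_m) :
  V \is unitarymx -> nrm (u *m V) = nrm u.
Proof.
move=> VU; rewrite /nrm !dotmxE trmx_mul map_mxM mulmxA.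
by rewrite -(mulmxA u) (unitarymxP VU) mulmx1.
Qed.

Lemma norm_le_nrm n (u : 'rV[C]_n) i : `|u 0 i| <= nrm u.
Proof.
rewrite -ler_sqr ?nnegrE ?nrm_ge0 // sqr_nrm (bigD1 i) //= lerDl.
by apply: sumr_ge0 => j _; rewrite exprn_ge0.
Qed.

End RowNorm.

Section OperatorBound.
Variable C : numClosedFieldType.

Definition opbound m n (M : 'M[C]_(m, n)) (c : C) : Prop :=
  forall u : 'rV[C]_m, nrm (u *m M) <= c * nrm u.

Lemma opboundD m n (M N : 'M[C]_(m, n)) c d :
  opbound M c -> opbound N d -> opbound (M + N) (c + d).
Proof.
move=> Mc Nd u; rewrite mulmxDr mulrDl.
by apply: le_trans (ler_nrmD _ _) _; apply: lerD.
Qed.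

Lemma opboundN m n (M : 'M[C]_(m, n)) c : opbound M c -> opbound (- M) c.
Proof. by move=> Mc u; rewrite mulmxN nrmN. Qed.

Lemma opboundM m n p (M : 'M[C]_(m, n)) (N : 'M[C]_(n, p)) c d :
  0 <= d -> opbound M c -> opbound N d -> opbound (M *m N) (c * d).
Proof.
move=> d0 Mc Nd u; rewrite mulmxA (le_trans (Nd _)) //.
by rewrite [c * d]mulrC -mulrA ler_wpM2l.
Qed.

Lemma opbound_le m n (M : 'M[C]_(m, n)) c d :
  c <= d -> opbound M c -> opbound M d.
Proof.
by move=> cd Mc u; rewrite (le_trans (Mc u)) // ler_wpM2r ?nrm_ge0.
Qed.

Lemma opbound_unitary m n (V : 'M[C]_(m, n)) : V \is unitarymx -> opbound V 1.
Proof. by move=> VU u; rewrite mul1r nrm_unitary. Qed.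

Lemma opbound_diag n (w : 'rV[C]_n) c :
  0 <= c -> (forall i, `|w 0 i| <= c) -> opbound (diag_mx w) c.
Proof.
move=> c0 wc u; apply: ler_nrm => //; rewrite !sqr_nrm mulr_sumr.
apply: ler_sum => i _; rewrite mul_mx_diag !mxE normrM exprMn mulrC.
by rewrite ler_wpM2r ?exprn_ge0 // ler_pXn2r ?nnegrE.
Qed.

Lemma opbound_exp n (M : 'M[C]_n) c k :
  0 <= c -> opbound M c -> opbound (M ^+ k) (c ^+ k).
Proof.
move=> c0 Mc; elim: k => [|k IH]; first by move=> u; rewrite mulmx1 mul1r.
by rewrite !exprS; apply: opboundM; rewrite ?exprn_ge0.
Qed.

(** Cauchy-Schwarz with weights: twice the difference of the two sides is the
    double sum of the [w i * w j * (a i - a j) ^+ 2]. *)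
Lemma sqr_sum_weight (I : finType) (w a : I -> C) :
  (forall i, 0 <= w i) -> (forall i, 0 <= a i) ->
  (\sum_i a i * w i) ^+ 2 <= (\sum_i w i) * \sum_i w i * a i ^+ 2.
Proof.
move=> w0 a0.
have -> : (\sum_i a i * w i) ^+ 2 = \sum_i \sum_j w i * w j * (a i * a j).
  rewrite expr2 mulr_suml; apply: eq_bigr => i _; rewrite mulr_sumr.
  by apply: eq_bigr => j _; ring.
have E : (\sum_i w i) * \sum_i w i * a i ^+ 2 =
         \sum_i \sum_j w i * w j * a j ^+ 2.
  rewrite mulr_suml; apply: eq_bigr => i _; rewrite mulr_sumr.
  by apply: eq_bigr => j _; ring.
have E2 : (\sum_i w i) * \sum_i w i * a i ^+ 2 =
         \sum_i \sum_j w i * w j * a i ^+ 2.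
  rewrite E exchange_big /=; apply: eq_bigr => i _.
  by apply: eq_bigr => j _; ring.
rewrite -(@ler_pM2l _ 2) // [leRHS]mulr_natl [leRHS]mulr2n {1}E E2 -big_split /=.
rewrite mulr_sumr; apply: ler_sum => i _; rewrite -big_split mulr_sumr /=.
apply: ler_sum => j _; rewrite -subr_ge0.
have -> : w i * w j * a j ^+ 2 + w i * w j * a i ^+ 2 -
          2 * (w i * w j * (a i * a j)) = (w i * w j) * (a i - a j) ^+ 2 by ring.
apply: mulr_ge0; first exact: mulr_ge0.
by rewrite -real_normK ?exprn_ge0 // rpredB // ger0_real.
Qed.

(** Schur test: apply weighted Cauchy-Schwarz along each column with weights
    [`|M i j|], then sum over the columns. *)
Lemma opbound_schur m n (M : 'M[C]_(m, n)) c :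
  0 <= c -> (forall i, \sum_j `|M i j| <= c) ->
  (forall j, \sum_i `|M i j| <= c) -> opbound M c.
Proof.
move=> c0 rc cc u; apply: ler_nrm => //; rewrite !sqr_nrm.
apply: (@le_trans _ _ (\sum_j c * \sum_i `|M i j| * `|u 0 i| ^+ 2)).
  apply: ler_sum => j _; rewrite mxE.
  apply: (@le_trans _ _ ((\sum_i `|u 0 i| * `|M i j|) ^+ 2)).
    have s0 : 0 <= \sum_i `|u 0 i| * `|M i j|.
      by apply: sumr_ge0 => i _; apply: mulr_ge0.
    rewrite ler_pXn2r ?nnegrE //.
    apply: le_trans (ler_norm_sum _ _ _) _.
    by apply: ler_sum => i _; rewrite normrM.
  apply: le_trans (sqr_sum_weight _ _) _ => //.
  apply: ler_wpM2r; last exact: cc.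
  by apply: sumr_ge0 => i _; rewrite mulr_ge0 ?exprn_ge0.
rewrite -mulr_sumr expr2 -mulrA ler_wpM2l // exchange_big /= mulr_sumr.
apply: ler_sum => i _; rewrite -mulr_suml ler_wpM2r ?exprn_ge0 ?rc //.
Qed.

End OperatorBound.

Lemma adjmxM (C : numClosedFieldType) m n p (A : 'M[C]_(m, n))
  (B : 'M[C]_(n, p)) : (A *m B)^t* = B^t* *m A^t*.
Proof. by rewrite trmx_mul map_mxM. Qed.

Section UnitaryDiagonal.
Variable C : numClosedFieldType.

(** For [V] the Fourier matrix this unfolds to [circulant_of], so that circulant
    and Hermitian matrices share one functional calculus. *)
Definition udiag n (V : 'M[C]_n) (w : 'rV[C]_n) : 'M[C]_n :=
  V^t* *m diag_mx w *m V.

Lemma opbound_udiag n (V : 'M[C]_n) (w : 'rV[C]_n) c :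
  V \is unitarymx -> 0 <= c -> (forall i, `|w 0 i| <= c) ->
  opbound (udiag V w) c.
Proof.
move=> VU c0 wc; rewrite -[c]mulr1 -[c]mul1r.
apply: opboundM; rewrite ?ler01 //; last exact: opbound_unitary.
by apply: opboundM => //; [apply: opbound_unitary; rewrite trmxC_unitary
                          | apply: opbound_diag].
Qed.

Lemma udiagM n (V : 'M[C]_n) (v w : 'rV[C]_n) : V \is unitarymx ->
  udiag V v *m udiag V w = udiag V (\row_i (v 0 i * w 0 i)).
Proof.
move=> VU; rewrite /udiag !mulmxA [X in X *m diag_mx w](mulmxtVK _ VU).
by rewrite -(mulmxA (V^t*)) mulmx_diag.
Qed.

Lemma udiag1 n (V : 'M[C]_n) : V \is unitarymx ->
  udiag V (const_mx 1) = 1%:M.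
Proof.
move=> VU; rewrite /udiag diag_const_mx mulmx1.
exact/mulmx1C/unitarymxP.
Qed.

Lemma udiag_exp n (V : 'M[C]_n) (w : 'rV[C]_n) k : V \is unitarymx ->
  udiag V w ^+ k = udiag V (\row_i (w 0 i ^+ k)).
Proof.
move=> VU; elim: k => [|k IH].
  rewrite expr0 -[RHS]/(udiag V _) -[LHS](udiag1 VU); congr udiag.
  by apply/rowP => i; rewrite !mxE.
rewrite exprS IH [LHS]udiagM //; congr udiag.
by apply/rowP => i; rewrite !mxE exprS.
Qed.

Lemma udiagB n (V : 'M[C]_n) (v w : 'rV[C]_n) :
  udiag V v - udiag V w = udiag V (v - w).
Proof. by rewrite /udiag linearB /= mulmxBr mulmxBl. Qed.

Lemma udiag_adj n (V : 'M[C]_n) (w : 'rV[C]_n) :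
  (udiag V w)^t* = udiag V (map_mx Num.conj w).
Proof.
by rewrite /udiag !trmx_mul !map_mxM tr_diag_mx map_diag_mx trmxCK mulmxA.
Qed.

Lemma udiagE n (V : 'M[C]_n) (w : 'rV[C]_n) i j :
  udiag V w i j = \sum_k w 0 k * ((V k i)^* * V k j).
Proof.
rewrite /udiag mxE; apply: eq_bigr => k _.
by rewrite mul_mx_diag !mxE; ring.
Qed.

Lemma udiag_unitary n (V : 'M[C]_n) (w : 'rV[C]_n) : V \is unitarymx ->
  (forall i, `|w 0 i| = 1) -> udiag V w \is unitarymx.
Proof.
move=> VU w1; apply/unitarymxP; rewrite udiag_adj udiagM // -[RHS](udiag1 VU).
congr udiag; apply/rowP => i; rewrite !mxE -normCK w1 expr1n //.
Qed.

Lemma udiag_inv n (V : 'M[C]_n) (w : 'rV[C]_n) : V \is unitarymx ->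
  (forall i, w 0 i != 0) ->
  udiag V w \in unitmx /\ invmx (udiag V w) = udiag V (map_mx GRing.inv w).
Proof.
move=> VU w0.
have E : udiag V w *m udiag V (map_mx GRing.inv w) = 1%:M.
  rewrite udiagM // -(udiag1 VU); congr udiag.
  by apply/rowP => i; rewrite !mxE mulfV.
have [u _] := mulmx1_unit E; split=> //.
by rewrite -[LHS]mulmx1 -E mulKmx.
Qed.

Lemma udiag_unitP n (V : 'M[C]_n) (w : 'rV[C]_n) : V \is unitarymx ->
  udiag V w \in unitmx -> forall i, w 0 i != 0.
Proof.
move=> VU; rewrite /udiag unitmx_mul (unitarymx_unit VU) andbT unitmx_mul.
move=> /andP[_]; rewrite unitmxE det_diag unitfE prodf_seq_neq0.
by move=> /allP wn i; apply: wn; rewrite mem_index_enum.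
Qed.

Lemma hermitian_udiag n (A : 'M[C]_n) : A^t* = A ->
  exists (V : 'M[C]_n) (w : 'rV[C]_n),
    [/\ V \is unitarymx, (forall i, w 0 i \is Num.real) & A = udiag V w].
Proof.
move=> AH; have Ah : A \is hermsymmx.
  by apply/is_hermitianmxP; rewrite expr0 scale1r AH.
exists (spectralmx A), (spectral_diag A); split.
- exact: spectral_unitarymx.
- by move=> i; have /mxOverP := hermitian_spectral_diag_real Ah; apply.
- have /hermitian_normalmx /orthomx_spectralP {1}-> := Ah.
  by rewrite invmx_unitary ?spectral_unitarymx.
Qed.

End UnitaryDiagonal.

Lemma row_udiag (C : numClosedFieldType) n (V : 'M[C]_n) (w : 'rV[C]_n) i :
  V \is unitarymx -> row i V *m udiag V w = w 0 i *: row i V.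
Proof.
move=> VU; rewrite /udiag !mulmxA -row_mul (unitarymxP VU) row1.
by rewrite -rowE row_diag_mx -scalemxAl -rowE.
Qed.

(** * Matrices of low rank up to a small error *)

Section LowRank.
Variable C : numClosedFieldType.

Definition lowrank_plus n k c (M : 'M[C]_n) : Prop :=
  exists L E : 'M[C]_n, [/\ M = L + E, (\rank L <= k)%N & opbound E c].

(** In terms of singular values: they cluster at zero, with a number [k] of
    outliers that is uniform in [n]. *)
Definition zero_clustered (X : forall n, 'M[C]_n) : Prop :=
  forall eps : C, 0 < eps -> exists k N : nat, forall n, (N < n)%N ->
    lowrank_plus k eps (X n).

Lemma zero_clusteredD (X Y : forall n, 'M[C]_n) :
  zero_clustered X -> zero_clustered Y -> zero_clustered (fun n => X n + Y n).
Proof.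
move=> Xz Yz e e0; have e20 : 0 < e / 2 by rewrite divr_gt0.
have [k [N HX]] := Xz _ e20; have [l [P HY]] := Yz _ e20.
exists (k + l)%N, (maxn N P) => n; rewrite gtn_max => /andP[nN nP].
have [L [E [-> Lk Ee]]] := HX _ nN; have [L' [E' [-> Lk' Ee']]] := HY _ nP.
exists (L + L'), (E + E'); split; first by rewrite addrACA.
  by rewrite (leq_trans (mxrank_add _ _)) // leq_add.
by rewrite [e]splitr; apply: opboundD.
Qed.

Lemma zero_clusteredMl (X Y : forall n, 'M[C]_n) c N0 : 0 <= c ->
  (forall n, (N0 < n)%N -> opbound (Y n) c) ->
  zero_clustered X -> zero_clustered (fun n => Y n *m X n).
Proof.
move=> c0 Yc Xz e e0; have c10 : 0 < c + 1 by rewrite ltr_wpDl.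
have [k [N HX]] := Xz _ (divr_gt0 e0 c10).
exists k, (maxn N0 N) => n; rewrite gtn_max => /andP[nN0 nN].
have [L [E [-> Lk Ee]]] := HX _ nN; exists (Y n *m L), (Y n *m E); split.
- by rewrite mulmxDr.
- exact: leq_trans (mxrankM_maxr _ _) Lk.
- apply: (@opbound_le _ _ _ _ ((c + 1) * (e / (c + 1)))).
    by rewrite mulrC divfK ?gt_eqF.
  apply: opboundM => //; first by rewrite divr_ge0 ?ltW.
  by apply: opbound_le (Yc _ nN0); rewrite lerDl.
Qed.

Lemma zero_clusteredMr (X Y : forall n, 'M[C]_n) c N0 : 0 <= c ->
  (forall n, (N0 < n)%N -> opbound (Y n) c) ->
  zero_clustered X -> zero_clustered (fun n => X n *m Y n).
Proof.
move=> c0 Yc Xz e e0; have c10 : 0 < c + 1 by rewrite ltr_wpDl.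
have [k [N HX]] := Xz _ (divr_gt0 e0 c10).
exists k, (maxn N0 N) => n; rewrite gtn_max => /andP[nN0 nN].
have [L [E [-> Lk Ee]]] := HX _ nN; exists (L *m Y n), (E *m Y n); split.
- by rewrite mulmxDl.
- exact: leq_trans (mxrankM_maxl _ _) Lk.
- apply: (@opbound_le _ _ _ _ ((e / (c + 1)) * (c + 1))).
    by rewrite divfK ?gt_eqF.
  apply: opboundM => //; first exact: ltW.
  by apply: opbound_le (Yc _ nN0); rewrite lerDl.
Qed.

Lemma opbound_scalar n (a : C) : opbound (a%:M : 'M[C]_n) `|a|.
Proof. by move=> u; rewrite mul_mx_scalar nrmZ. Qed.

Lemma zero_clusteredZ (X : forall n, 'M[C]_n) a :
  zero_clustered X -> zero_clustered (fun n => a *: X n).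
Proof.
move=> Xz e e0.
have [k [N H]] := @zero_clusteredMl X (fun n => a%:M) `|a| 0%N (normr_ge0 a)
  (fun n _ => @opbound_scalar n a) Xz e e0.
by exists k, N => n nN; rewrite -mul_scalar_mx; exact: H.
Qed.

Lemma zero_clustered0 : zero_clustered (fun n => 0).
Proof.
move=> e e0; exists 0%N, 0%N => n _; exists 0, 0; split; rewrite ?addr0 //.
  by rewrite mxrank0.
move=> u; rewrite mulmx0; have -> : (0 : 'rV[C]_n) = 0 *: u by rewrite scale0r.
by rewrite nrmZ normr0 mul0r mulr_ge0 ?nrm_ge0 // ltW.
Qed.

Lemma zero_clustered_sum (X : nat -> forall n, 'M[C]_n) K :
  (forall k, zero_clustered (X k)) ->
  zero_clustered (fun n => \sum_(k < K) X k n).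
Proof.
move=> Xz; elim: K => [|K IH] e e0.
  have [k [N H]] := zero_clustered0 e0.
  by exists k, N => n nN; rewrite big_ord0; exact: H.
have [k [N H]] := zero_clusteredD IH (Xz K) e0.
by exists k, N => n nN; rewrite big_ord_recr /=; exact: H.
Qed.

Lemma zero_clustered_lim (X : forall n, 'M[C]_n) :
  (forall eps : C, 0 < eps -> exists Y : forall n, 'M[C]_n,
     zero_clustered Y /\
     exists N : nat, forall n, (N < n)%N -> opbound (X n - Y n) eps) ->
  zero_clustered X.
Proof.
move=> H e e0; have e20 : 0 < e / 2 by rewrite divr_gt0.
have [Y [Yz [N XY]]] := H _ e20; have [k [P HY]] := Yz _ e20.
exists k, (maxn N P) => n; rewrite gtn_max => /andP[nN nP].
have [L [E [YE Lk Ee]]] := HY _ nP; exists L, (E + (X n - Y n)); split => //.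
  by rewrite addrA -YE addrC subrK.
by rewrite [e]splitr; apply: opboundD => //; exact: XY.
Qed.

(** Telescoping: [A^k.+1 - B^k.+1 = A^k (A - B) + (A^k - B^k) B]. *)
Lemma zero_clustered_exp (A B : forall n, 'M[C]_n) c N0 k : 0 <= c ->
  (forall n, (N0 < n)%N -> opbound (A n) c) ->
  (forall n, (N0 < n)%N -> opbound (B n) c) ->
  zero_clustered (fun n => A n - B n) ->
  zero_clustered (fun n => A n ^+ k - B n ^+ k).
Proof.
move=> c0 Ac Bc ABz; elim: k => [|k IH] e e0.
  have [l [N H]] := zero_clustered0 e0.
  by exists l, N => n nN; rewrite !expr0 subrr; exact: H.
have Ack n : (N0 < n)%N -> opbound (A n ^+ k) (c ^+ k).
  by move=> nN; apply: opbound_exp => //; exact: Ac.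
have H1 := zero_clusteredMl (exprn_ge0 k c0) Ack ABz.
have H2 := zero_clusteredMr c0 Bc IH.
have [l [N H]] := zero_clusteredD H1 H2 e0.
exists l, N => n nN.
suff -> : A n ^+ k.+1 - B n ^+ k.+1 = A n ^+ k *m (A n - B n) +
  (A n ^+ k - B n ^+ k) *m B n by exact: H.
by rewrite mulmxBr mulmxBl addrA subrK !exprSr.
Qed.

(** The span of [#|S|] rows of [V] has dimension larger than the rank of [L],
    so it meets the kernel of [L]. *)
Lemma support_vector n k (V L : 'M[C]_n) (S : {set 'I_n}) :
  V \is unitarymx -> (\rank L <= k)%N -> (k < #|S|)%N ->
  exists y : 'rV[C]_n,
    [/\ y != 0, y *m V *m L = 0 & forall i, i \notin S -> y 0 i = 0].
Proof.
move=> VU Lk kS.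
pose W := \matrix_(i < #|S|) delta_mx 0 (enum_val i) : 'M[C]_(#|S|, n).
have WW : W *m W^T = 1%:M.
  apply/matrixP => i j; rewrite !mxE (bigD1 (enum_val i)) //= big1 => [|l li].
    by rewrite !mxE !eqxx addr0 mul1r (inj_eq enum_val_inj).
  by rewrite !mxE (negPf li) andbF mul0r.
have : kermx (W *m V *m L) != 0.
  rewrite -mxrank_eq0 mxrank_ker subn_eq0 -ltnNge.
  by apply: leq_ltn_trans kS; apply: leq_trans Lk; exact: mxrankM_maxr.
move=> /rowV0Pn[x /sub_kermxP xk x0]; exists (x *m W); split.
- apply: contraNneq x0 => xW; rewrite -[x]mulmx1 -WW mulmxA xW mul0mx //.
- by rewrite -!mulmxA mulmxA; rewrite -[X in _ = X]xk !mulmxA.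
- move=> i iS; rewrite mxE big1 // => j _; rewrite !mxE.
  case: (eqVneq i (enum_val j)) => [E|_]; last by rewrite andbF mulr0.
  by move: iS; rewrite E enum_valP.
Qed.

(** On a vector killed by the low-rank part, [udiag V w] acts as [S] up to [c],
    hence multiplies the norm by a factor between [1 - c] and [1 + c].  A vector
    supported on the eigenvalues of modulus at most [1 - e], or on those of
    modulus at least [1 + e], contradicts this; so each of the two groups has at
    most [k] elements. *)
Lemma count_near_unitary n k (c e : C) (V S M : 'M[C]_n) (w : 'rV[C]_n) :
  V \is unitarymx -> S \is unitarymx -> udiag V w = S + M ->
  lowrank_plus k c M -> c < e ->
  (#|[set i | ((`|w 0 i| <= 1 - e) || (1 + e <= `|w 0 i|))%R]| <= k + k)%N.
Proof.
move=> VU SU HE [L [E [ME Lk Ec]]] ce.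
have act (y : 'rV[C]_n) : nrm (y *m V *m udiag V w) = nrm (y *m diag_mx w).
  by rewrite /udiag !mulmxA (mulmxtVK _ VU) nrm_unitary.
have actS (y : 'rV[C]_n) : y *m V *m L = 0 -> exists2 z : 'rV[C]_n,
    y *m V *m udiag V w = y *m V *m S + z & nrm z <= c * nrm y.
  move=> yL; exists (y *m V *m E).
    by rewrite HE ME !mulmxDr yL add0r.
  by rewrite (le_trans (Ec _)) // nrm_unitary.
have lowP : (#|[set i | (`|w 0 i| <= 1 - e)%R]| <= k)%N.
  rewrite leqNgt; apply/negP => kS.
  have [y [y0 yL yS]] := support_vector VU Lk kS.
  have [z zE zc] := actS _ yL.
  have [i iS] : exists i, i \in [set i | (`|w 0 i| <= 1 - e)%R].
    by apply/set0Pn; rewrite -card_gt0 (leq_ltn_trans _ kS).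
  have e1 : 0 <= 1 - e by move: iS; rewrite inE; apply: le_trans.
  have : nrm (y *m diag_mx w) <= (1 - e) * nrm y.
    apply: ler_nrm => //; rewrite !sqr_nrm mulr_sumr; apply: ler_sum => j _.
    rewrite mul_mx_diag mxE normrM exprMn mulrC.
    have [jS|/yS ->] := boolP (j \in [set i | (`|w 0 i| <= 1 - e)%R]).
      rewrite inE in jS; apply: ler_wpM2r; first exact: exprn_ge0.
      by rewrite ler_pXn2r ?nnegrE.
    by rewrite normr0 expr0n /= !mulr0.
  rewrite -act zE => le1.
  have : nrm y <= nrm (y *m V *m S + z) + nrm z.
    apply: le_trans (ler_nrmB _ _); rewrite addrK !nrm_unitary //.
  move=> /le_trans /(_ (lerD le1 zc)); rewrite -mulrDl.
  rewrite -[leLHS]mul1r ler_pM2r ?nrm_gt0 // -subr_ge0.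
  have -> : 1 - e + c - 1 = c - e by ring.
  by rewrite subr_ge0 => /(lt_le_trans ce); rewrite ltxx.
have highP : (#|[set i | (1 + e <= `|w 0 i|)%R]| <= k)%N.
  rewrite leqNgt; apply/negP => kS.
  have [y [y0 yL yS]] := support_vector VU Lk kS.
  have [z zE zc] := actS _ yL.
  have c0 : 0 <= c.
    by rewrite -(@pmulr_lge0 _ (nrm y)) ?nrm_gt0 // (le_trans _ zc) ?nrm_ge0.
  have e1 : 0 <= 1 + e by rewrite addr_ge0 // (le_trans c0) // ltW.
  have : (1 + e) * nrm y <= nrm (y *m diag_mx w).
    rewrite -ler_sqr ?nnegrE ?mulr_ge0 ?nrm_ge0 // exprMn.
    rewrite !sqr_nrm mulr_sumr; apply: ler_sum => j _.
    rewrite mul_mx_diag mxE normrM exprMn [leRHS]mulrC.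
    have [jS|/yS ->] := boolP (j \in [set i | (1 + e <= `|w 0 i|)%R]).
      rewrite inE in jS; apply: ler_wpM2r; first exact: exprn_ge0.
      by rewrite ler_pXn2r ?nnegrE.
    by rewrite normr0 expr0n /= !mulr0.
  rewrite -act zE => /le_trans /(_ (ler_nrmD _ _)).
  move=> /le_trans /(_ (lerD (lexx _) zc)).
  rewrite !nrm_unitary // -[X in _ <= X + _]mul1r -mulrDl.
  rewrite ler_pM2r ?nrm_gt0 // lerD2l => /(lt_le_trans ce).
  by rewrite ltxx.
apply: leq_trans (leq_add lowP highP).
have -> : [set i | (`|w 0 i| <= 1 - e) || (1 + e <= `|w 0 i|)] =
  [set i | (`|w 0 i| <= 1 - e)%R] :|: [set i | (1 + e <= `|w 0 i|)%R].
  by apply/setP => i; rewrite !inE.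
by rewrite cardsU leq_subr.
Qed.

End LowRank.

Local Open Scope classical_set_scope.
Local Open Scope ring_scope.
Local Open Scope complex_scope.
Local Open Scope sesquilinear_scope.

(** * Real scalars in the complex field and power series of matrices *)

Section RealComplex.
Variable R : realType.
Local Notation C := R[i].

Lemma normC_real (x : R) : `|x%:C| = `|x|%:C :> C.
Proof. by rewrite normc_def /= expr0n addr0 sqrtr_sqr. Qed.

Lemma modulusM (z w : C) : modulus (z * w) = modulus z * modulus w.
Proof. by apply: complexI; rewrite rmorphM !modulusE normrM. Qed.

Lemma modulusX (z : C) k : modulus (z ^+ k) = modulus z ^+ k.
Proof. by apply: complexI; rewrite rmorphXn !modulusE normrX. Qed.

Lemma modulus_ge0 (z : C) : 0 <= modulus z.
Proof. by rewrite -ler0c modulusE. Qed.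

Lemma modulus_real (x : R) : modulus x%:C = `|x|.
Proof. by apply: complexI; rewrite modulusE normC_real. Qed.

Lemma cvg_realC (u : nat -> R) (l : R) :
  u n @[n --> \oo] --> l -> ((u n)%:C : C^o) @[n --> \oo] --> (l%:C : C^o).
Proof.
move=> /cvgrPdist_lt ul; apply/cvgrPdist_lt => e e0.
have eE : e = (complex.Re e)%:C by rewrite RRe_real // gtr0_real.
rewrite eE ltcR in e0; have [N _ HN] := ul _ e0.
exists N => // n nN; rewrite eE -rmorphB normC_real ltcR; exact: HN.
Qed.

End RealComplex.

Lemma ltr0C (R : realType) (x : R) : (0 < x%:C :> R[i]) = (0 < x).
Proof. exact: ltcR. Qed.

Lemma udiag_realM (R : realType) n (V : 'M[R[i]]_n) (x y : 'I_n -> R) :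
  V \is unitarymx ->
  udiag V (\row_i (x i)%:C) *m udiag V (\row_i (y i)%:C) =
  udiag V (\row_i (x i * y i)%:C).
Proof.
move=> VU; rewrite (udiagM _ _ VU); congr udiag; apply/rowP => i.
by rewrite !mxE rmorphM.
Qed.

Lemma udiag_real_adj (R : realType) n (V : 'M[R[i]]_n) (x : 'I_n -> R) :
  (udiag V (\row_i (x i)%:C))^t* = udiag V (\row_i (x i)%:C).
Proof.
rewrite udiag_adj; congr udiag; apply/rowP => i; rewrite !mxE.
exact: conjc_real.
Qed.

Section PowerSeriesConvergence.
Variable R : realType.
Local Notation C := R[i].

(** Abel's lemma: the series converges at some [z] with [rho < |z|], its terms
    there are bounded, and comparison with the geometric series of ratio
    [rho / |z|] follows. *)
Lemma cvg_series_in_radius (a : nat -> C) (rho : R) : 0 < rho ->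
  (rho%:E < conv_radius a)%E ->
  cvgn (series (fun k => modulus (a k) * rho ^+ k)).
Proof.
move=> rho0 /ereal_sup_gt[_ [z /= zc <-]]; rewrite lte_fin => rz.
have z0 : 0 < modulus z by exact: lt_trans rz.
have [N _ HN] : \forall k \near \oo, `|0 - a k * z ^+ k| < (1 : C).
  by move/cvgrPdist_lt : (cvg_series_cvg_0 zc); apply.
pose B := 1 + \sum_(j < N) modulus (a j) * modulus z ^+ j.
have t0 j : 0 <= modulus (a j) * modulus z ^+ j.
  by rewrite mulr_ge0 ?exprn_ge0 ?modulus_ge0.
have bnd k : modulus (a k) * modulus z ^+ k <= B.
  have [kN|Nk] := ltnP k N.
    rewrite /B (bigD1 (Ordinal kN)) //= addrCA lerDl.
    by rewrite addr_ge0 // sumr_ge0.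
  have := HN k Nk; rewrite sub0r normrN -modulusE (ltcR _ 1) modulusM modulusX.
  by move=> /ltW /le_trans; apply; rewrite lerDl sumr_ge0.
have B0 : 0 <= B by rewrite addr_ge0 // sumr_ge0.
have q1 : `|rho / modulus z| < 1.
  by rewrite ger0_norm ?divr_ge0 ?(ltW rho0) ?ltW // ltr_pdivrMr // mul1r.
apply: (series_le_cvg _ _ _ (is_cvg_geometric_series (a := B) q1)) => k /=.
- by rewrite mulr_ge0 ?exprn_ge0 ?modulus_ge0 // ltW.
- by rewrite mulr_ge0 // exprn_ge0 // divr_ge0 // ltW.
- rewrite expr_div_n mulrA ler_pdivlMr ?exprn_gt0 //.
  rewrite mulrAC; apply: ler_wpM2r; first by rewrite exprn_ge0 // ltW.
  exact: bnd.
Qed.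

Variables (b : nat -> R) (rho : R).
Hypothesis rho_ge0 : 0 <= rho.
Hypothesis b_cvg : cvgn (series (fun k => `|b k| * rho ^+ k)).

Definition psum (x : R) : R := limn (series (fun k => b k * x ^+ k)).

Lemma term_le x k : `|x| <= rho -> `|b k * x ^+ k| <= `|b k| * rho ^+ k.
Proof.
move=> xr; rewrite normrM normrX ler_wpM2l //.
by rewrite lerXn2r ?nnegrE.
Qed.

Lemma psum_cvg x : `|x| <= rho ->
  series (fun k => b k * x ^+ k) n @[n --> \oo] --> psum x.
Proof.
move=> xr; apply: normed_cvg.
apply: series_le_cvg b_cvg => k //=; first by rewrite mulr_ge0 ?exprn_ge0.
exact: term_le.
Qed.

(** The tail is dominated by that of the series of the [`|b k| * rho ^+ k],
    whence the uniformity in [x]. *)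
Lemma psum_tail (e : R) : 0 < e -> exists K : nat, forall x, `|x| <= rho ->
  `|psum x - \sum_(k < K) b k * x ^+ k| <= e.
Proof.
move=> e0; pose S := series (fun k => `|b k| * rho ^+ k).
have Sc : cvgn S := b_cvg.
move: (Sc) => /cvgrPdist_lt /(_ _ e0)[K _ HK]; exists K => x xr.
have HK' := HK K (leqnn K).
have S_le : S K <= limn S.
  by apply: nondecreasing_cvgn_le => //; apply: nondecreasing_series => k _ _;
     rewrite mulr_ge0 ?exprn_ge0.
have cv : `|series (fun k => b k * x ^+ k) n - \sum_(k < K) b k * x ^+ k|
    @[n --> \oo] --> `|psum x - \sum_(k < K) b k * x ^+ k|.
  by apply: cvg_norm; apply: cvgB; [exact: psum_cvg | exact: cvg_cst].
apply: (ler_cvg_to cv (cvg_cst e)); exists K => // n /= Kn.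
rewrite -(big_mkord xpredT (fun k => b k * x ^+ k)) /series /=.
rewrite (big_cat_nat (leq0n K) Kn) //= addrAC subrr add0r.
apply: le_trans (ler_norm_sum _ _ _) _.
have : \sum_(K <= k < n) `|b k * x ^+ k| <= S n - S K.
  rewrite /S /series /= (big_cat_nat (leq0n K) Kn) //= addrAC subrr add0r.
  by apply: ler_sum => k _; exact: term_le.
move=> /le_trans; apply; apply: (le_trans _ (ltW HK')).
rewrite ger0_norm ?subr_ge0 // lerD2r.
apply: nondecreasing_cvgn_le => //; apply: nondecreasing_series => k _ _.
by rewrite mulr_ge0 ?exprn_ge0.
Qed.

(** An entry of a power of [udiag V mu] is a fixed linear combination of the
    powers of the [mu l], so the limit may be taken on each eigenvalue. *)
Lemma matrix_fun_udiag n (V : 'M[C]_n) (mu : 'I_n -> R) : V \is unitarymx ->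
  (forall i, `|mu i| <= rho) ->
  matrix_fun (fun k => (b k)%:C) (udiag V (\row_i (mu i)%:C)) =
  udiag V (\row_i (psum (mu i))%:C).
Proof.
move=> VU mur; apply/matrixP => i j; rewrite mxE udiagE.
have haus : hausdorff_space C^o by exact: (@norm_hausdorff C C^o).
apply: (cvg_lim haus).
have -> : series (fun k => (b k)%:C *
      (udiag V (\row_i (mu i)%:C) ^+ k) i j : C^o) =
    fun n => \sum_l (series (fun k => b k * mu l ^+ k) n)%:C *
              (Num.conj (V l i) * V l j).
  apply/funext => N; rewrite /series /=.
  under eq_bigr do rewrite udiag_exp // udiagE mulr_sumr.
  rewrite exchange_big /=; apply: eq_bigr => l _.
  rewrite rmorph_sum mulr_suml; apply: eq_bigr => k _.
  by rewrite !mxE rmorphM rmorphXn /= !mulrA.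
apply: cvg_big; first exact: add_continuous.
move=> l _.
rewrite mxE; apply: cvgMr_tmp.
exact/cvg_realC/psum_cvg.
Qed.

End PowerSeriesConvergence.

(** * Toeplitz matrices as quadratic forms *)

Section ComplexIntegral.
Variable R : realType.
Local Notation C := R[i].
Local Notation D := (`[- pi, pi]%classic : set R).
Local Notation Re := complex.Re.
Local Notation Im := complex.Im.

Definition ccontinuous (F : R -> C) : Prop :=
  continuous (fun x => Re (F x)) /\ continuous (fun x => Im (F x)).

Lemma ReM (z w : C) : Re (z * w) = Re z * Re w - Im z * Im w.
Proof. by case: z w => [a b] [c d]. Qed.

Lemma ImM (z w : C) : Im (z * w) = Re z * Im w + Im z * Re w.
Proof. by case: z w => [a b] [c d]. Qed.

Lemma ReD (z w : C) : Re (z + w) = Re z + Re w.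
Proof. by case: z w => [a b] [c d]. Qed.

Lemma ImD (z w : C) : Im (z + w) = Im z + Im w.
Proof. by case: z w => [a b] [c d]. Qed.

Lemma ccontinuousM (F G : R -> C) :
  ccontinuous F -> ccontinuous G -> ccontinuous (fun x => F x * G x).
Proof.
move=> [Fr Fi] [Gr Gi]; split.
  have -> : (fun x => Re (F x * G x)) =
    (fun x => Re (F x) * Re (G x) - Im (F x) * Im (G x)).
    by apply/funext => x; rewrite ReM.
  by move=> x; apply: cvgB; apply: cvgM; [exact: Fr|exact: Gr|exact: Fi|exact: Gi].
have -> : (fun x => Im (F x * G x)) =
  (fun x => Re (F x) * Im (G x) + Im (F x) * Re (G x)).
  by apply/funext => x; rewrite ImM.
by move=> x; apply: cvgD; apply: cvgM; [exact: Fr|exact: Gi|exact: Fi|exact: Gr].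
Qed.

Lemma ccontinuousD (F G : R -> C) :
  ccontinuous F -> ccontinuous G -> ccontinuous (fun x => F x + G x).
Proof.
move=> [Fr Fi] [Gr Gi]; split.
  have -> : (fun x => Re (F x + G x)) = (fun x => Re (F x) + Re (G x)).
    by apply/funext => x; rewrite ReD.
  by move=> x; apply: cvgD; [exact: Fr|exact: Gr].
have -> : (fun x => Im (F x + G x)) = (fun x => Im (F x) + Im (G x)).
  by apply/funext => x; rewrite ImD.
by move=> x; apply: cvgD; [exact: Fi|exact: Gi].
Qed.

Lemma ccontinuous_cst (c : C) : ccontinuous (fun=> c).
Proof. by split => x; exact: cvg_cst. Qed.

Lemma ccontinuous_sum (I : Type) (s : seq I) (F : I -> R -> C) :
  (forall i, ccontinuous (F i)) -> ccontinuous (fun x => \sum_(i <- s) F i x).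
Proof.
move=> Fc; elim: s => [|i s IH].
  have -> : (fun x => \sum_(i <- [::]) F i x) = (fun=> 0).
    by apply/funext => x; rewrite big_nil.
  exact: ccontinuous_cst.
have -> : (fun x => \sum_(j <- i :: s) F j x) =
          (fun x => F i x + \sum_(j <- s) F j x).
  by apply/funext => x; rewrite big_cons.
exact: ccontinuousD.
Qed.

Lemma ccontinuous_real (f : R -> R) :
  continuous f -> ccontinuous (fun x => (f x)%:C).
Proof. by move=> fc; split => // x; exact: cvg_cst. Qed.

Lemma ccontinuous_expi (c : R) : ccontinuous (fun x => expi (c * x)).
Proof.
have lin : continuous (fun x : R => c * x).
  by move=> x; apply: cvgMl_tmp; exact: cvg_id.
split=> x /=.
  apply: (@continuous_comp _ _ _ (fun x => c * x) (@cos R)); first exact: lin.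
  exact: continuous_cos.
apply: (@continuous_comp _ _ _ (fun x => c * x) (@sin R)); first exact: lin.
exact: continuous_sin.
Qed.

Lemma integrable_pi (f : R -> R) :
  continuous f -> lebesgue_measure.-integrable D (EFin \o f).
Proof.
move=> fc; apply: continuous_compact_integrable; first exact: segment_compact.
exact: continuous_subspaceT.
Qed.

Lemma cintegralD (F G : R -> C) : ccontinuous F -> ccontinuous G ->
  cintegral D (fun x => F x + G x) = cintegral D F + cintegral D G.
Proof.
move=> [Fr Fi] [Gr Gi]; rewrite /cintegral.
under eq_Rintegral do rewrite ReD.
under [X in _ +i* X]eq_Rintegral do rewrite ImD.
by rewrite !RintegralD //; exact: integrable_pi.
Qed.

Lemma cintegralZ (c : C) (F : R -> C) : ccontinuous F ->
  cintegral D (fun x => c * F x) = c * cintegral D F.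
Proof.
move=> [Fr Fi]; rewrite /cintegral.
have ZI (a : R) (h : R -> R) : continuous h -> continuous (fun x => a * h x).
  by move=> hc x; apply: cvgMl_tmp; exact: hc.
under eq_Rintegral do rewrite ReM.
under [X in _ +i* X]eq_Rintegral do rewrite ImM.
rewrite RintegralB ?RintegralD //; try by apply: integrable_pi; exact: ZI.
rewrite !RintegralZl //; try exact: integrable_pi.
by case: c.
Qed.

Lemma cintegral0 : cintegral D (fun=> 0) = 0 :> C.
Proof. by rewrite /cintegral /= !Rintegral_cst // !mul0r. Qed.

Lemma cintegral_sum (I : Type) (s : seq I) (F : I -> R -> C) :
  (forall i, ccontinuous (F i)) ->
  cintegral D (fun x => \sum_(i <- s) F i x) = \sum_(i <- s) cintegral D (F i).
Proof.
move=> Fc; elim: s => [|i s IH].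
  rewrite big_nil -[RHS]cintegral0; congr cintegral.
  by apply/funext => x; rewrite big_nil.
rewrite big_cons -IH -cintegralD //; last exact: ccontinuous_sum.
by congr cintegral; apply/funext => x; rewrite big_cons.
Qed.

Lemma cintegral_conj (F : R -> C) : ccontinuous F ->
  Num.conj (cintegral D F) = cintegral D (fun x => Num.conj (F x)).
Proof.
move=> [Fr Fi]; rewrite /cintegral -[LHS]/(_ +i* _); congr (_ +i* _).
  by congr Rintegral; apply/funext => x; case: (F x).
have -> : (fun x => Im (Num.conj (F x))) = (fun x => -1 * Im (F x)).
  by apply/funext => x; rewrite mulN1r; case: (F x).
by rewrite RintegralZl ?mulN1r //; exact: integrable_pi.
Qed.

Lemma cintegral_real (f : R -> R) :
  cintegral D (fun x => (f x)%:C) = (\int[lebesgue_measure]_(x in D) f x)%:C.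
Proof. by rewrite /cintegral /= Rintegral_cst // mul0r. Qed.

Lemma fourier_integrand_cont (f : R -> R) k : continuous f ->
  ccontinuous (fun x => (f x)%:C * expi (- (k%:~R * x))).
Proof.
move=> fc; apply: ccontinuousM; first exact: ccontinuous_real.
have -> : (fun x : R => expi (- (k%:~R * x))) = fun x => expi (- k%:~R * x).
  by apply/funext => x; rewrite mulNr.
exact: ccontinuous_expi.
Qed.

Lemma fourier_coef_conj (f : R -> R) k : continuous f ->
  Num.conj (fourier_coef f k) = fourier_coef f (- k).
Proof.
move=> fc; rewrite /fourier_coef rmorphM /=.
have -> : Num.conj ((2 * pi)^-1)%:C = ((2 * pi)^-1)%:C :> C by exact: conjc_real.
congr (_ * _); rewrite cintegral_conj; last exact: fourier_integrand_cont.
congr cintegral; apply/funext => x; rewrite rmorphM /= conj_expi.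
have -> : Num.conj (f x)%:C = (f x)%:C :> C by exact: conjc_real.
by rewrite opprK mulrNz mulNr opprK.
Qed.

Lemma toeplitz_hermitian (f : R -> R) n : continuous f ->
  (toeplitz f n)^t* = toeplitz f n.
Proof.
move=> fc; apply/matrixP => i j; rewrite !mxE fourier_coef_conj //.
by rewrite opprB.
Qed.

Definition trig_poly n (u : 'rV[C]_n) (x : R) : C :=
  \sum_j u 0 j * expi (- (j%:R * x)).

Lemma trig_poly_cont n (u : 'rV[C]_n) : ccontinuous (trig_poly u).
Proof.
apply: ccontinuous_sum => j; apply: ccontinuousM; first exact: ccontinuous_cst.
have -> : (fun x : R => expi (- (j%:R * x))) = fun x => expi (- j%:R * x).
  by apply/funext => x; rewrite mulNr.
exact: ccontinuous_expi.
Qed.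

Lemma sqr_modulus (z : C) : modulus z ^+ 2 = Re z ^+ 2 + Im z ^+ 2.
Proof. by apply: complexI; rewrite rmorphXn /= modulusE add_Re2_Im2. Qed.

Lemma trig_poly_sqr_cont n (u : 'rV[C]_n) :
  continuous (fun x => modulus (trig_poly u x) ^+ 2).
Proof.
have [ur ui] := trig_poly_cont u.
have -> : (fun x => modulus (trig_poly u x) ^+ 2) =
  (fun x => Re (trig_poly u x) * Re (trig_poly u x) +
            Im (trig_poly u x) * Im (trig_poly u x)).
  by apply/funext => x; rewrite sqr_modulus !expr2.
by move=> x; apply: cvgD; apply: cvgM;
  [exact: ur|exact: ur|exact: ui|exact: ui].
Qed.

(** The kernel [e^(- i (j - k) x)] factors, and the double sum under the
    integral is the squared modulus of the trigonometric polynomial of [u]. *)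
Lemma toeplitz_form (f : R -> R) n (u : 'rV[C]_n) : continuous f ->
  (u *m toeplitz f n *m u^t* ) 0 0 =
  ((2 * pi)^-1 * \int[lebesgue_measure]_(x in D)
     (f x * modulus (trig_poly u x) ^+ 2))%:C.
Proof.
move=> fc; rewrite rmorphM /= -cintegral_real.
have -> : (fun x => (f x * modulus (trig_poly u x) ^+ 2)%:C) =
  (fun x => \sum_k \sum_j (u 0 j * Num.conj (u 0 k)) *
    ((f x)%:C * expi (- ((Posz j - Posz k)%:~R * x)))).
  apply/funext => x; rewrite rmorphM rmorphXn /= modulusE normCK mulrCA.
  rewrite [Num.conj _]rmorph_sum !mulr_sumr; apply: eq_bigr => k _.
  rewrite [trig_poly u x]/trig_poly mulr_suml; apply: eq_bigr => j _.
  rewrite rmorphM /= conj_expi opprK.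
  have -> : - ((Posz j - Posz k)%:~R * x) = - (j%:R * x) + k%:R * x.
    by rewrite intrB mulrBl opprB addrC.
  by rewrite expiD; ring.
have cc k j : ccontinuous (fun x : R => (u 0 j * Num.conj (u 0 k)) *
    ((f x)%:C * expi (- ((Posz j - Posz k)%:~R * x)))).
  apply: ccontinuousM; first exact: ccontinuous_cst.
  exact: fourier_integrand_cont.
rewrite cintegral_sum => [|k]; last by apply: ccontinuous_sum => j; exact: cc.
rewrite mxE mulr_sumr; apply: eq_bigr => k _; rewrite cintegral_sum; last exact: cc.
rewrite !mxE mulr_suml mulr_sumr; apply: eq_bigr => j _.
rewrite !mxE /fourier_coef cintegralZ; last exact: fourier_integrand_cont.
by ring.
Qed.

End ComplexIntegral.

Section ToeplitzSpectrum.
Variable R : realType.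
Local Notation C := R[i].
Local Notation D := (`[- pi, pi]%classic : set R).
Local Notation Re := (@complex.Re R).
Local Notation Im := (@complex.Im R).

Lemma pi2_gt0 : 0 < 2 * pi :> R.
Proof. by rewrite mulr_gt0 // pi_gt0. Qed.

Lemma Rintegral_FTC (f F : R -> R) : continuous f ->
  (forall x : R, is_derive x 1 F (f x)) ->
  \int[lebesgue_measure]_(x in D) f x = F pi - F (- pi).
Proof.
move=> fc FD.
have Fc : continuous F.
  move=> x; apply/differentiable_continuous; rewrite -derivable1_diffP.
  by have [] := FD x.
have pp : - pi < pi :> R by rewrite -subr_gt0 opprK -mulr2n -mulr_natl pi2_gt0.
rewrite /Rintegral (@continuous_FTC2 _ f F) //.
- exact: continuous_subspaceT.
- split=> [x _||].
  + by have [] := FD x.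
  + by apply: cvg_at_right_filter; exact: Fc.
  + by apply: cvg_at_left_filter; exact: Fc.
- by move=> x _; rewrite derive1E; have [] := FD x.
Qed.

Lemma sin_int_pi (k : int) : sin (k%:~R * pi) = 0 :> R.
Proof.
have nat_case n : sin (n%:R * pi) = 0 :> R.
  have := congr1 Im (expiMn (pi : R) n).
  have -> : expi (pi : R) = (-1)%:C by rewrite /expi sinpi cospi.
  by rewrite -rmorphXn /= mulr_natl.
case: k => n; first exact: nat_case.
by rewrite NegzE mulrNz mulNr sinN nat_case oppr0.
Qed.

Lemma fourier_coef_cst (c : R) (k : int) :
  fourier_coef (fun=> c) k = (if k == 0 then c else 0)%:C.
Proof.
have tp := pi2_gt0.
rewrite /fourier_coef cintegralZ; last first.
  have -> : (fun x : R => expi (- (k%:~R * x))) = fun x => expi (- k%:~R * x).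
    by apply/funext => x; rewrite mulNr.
  exact: ccontinuous_expi.
have [->|k0] := eqVneq k 0.
  have -> : (fun x : R => expi (- (0%:~R * x))) = fun x => (1 : R)%:C.
    by apply/funext => x; rewrite mul0r oppr0 expi0.
  rewrite cintegral_real (@Rintegral_FTC _ id); last by move=> x; exact: cvg_cst.
  rewrite opprK -!rmorphM /= -mulr2n -mulr_natl; congr (_%:C).
  by have := pi_gt0 R; move: (pi : R) => p p0; field; rewrite gt_eqF.
have kR : (k%:~R : R) != 0 by rewrite intr_eq0.
have lin (x : R) : is_derive x 1 (fun x : R => - (k%:~R * x)) (- k%:~R).
  have -> : (fun x : R => - (k%:~R * x)) = (- k%:~R) \*: id.
    by apply/funext => y; rewrite /= scaleNr.
  by apply: is_derive_eq; rewrite /GRing.scale /= mulr1.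
have linc : continuous (fun x : R => - (k%:~R * x)).
  move=> x; apply/differentiable_continuous; rewrite -derivable1_diffP.
  by have [] := lin x.
suff -> : cintegral D (fun x : R => expi (- (k%:~R * x))) = 0.
  by rewrite !mulr0.
rewrite /cintegral /=.
have cosc : continuous (fun x : R => cos (- (k%:~R * x))).
  by move=> x; exact: (cvg_comp _ _ (linc x) (@continuous_cos R _)).
have sinc : continuous (fun x : R => sin (- (k%:~R * x))).
  by move=> x; exact: (cvg_comp _ _ (linc x) (@continuous_sin R _)).
have cosD (x : R) : is_derive x 1
    (fun x => - k%:~R^-1 * sin (- (k%:~R * x))) (cos (- (k%:~R * x))).
  have := @is_derive1_comp R (@sin R) _ x _ _ (is_derive_sin _) (lin x).
  move=> /(is_deriveZ (- k%:~R^-1)).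
  by move=> /is_derive_eq; apply; rewrite /GRing.scale /=; field.
have sinD (x : R) : is_derive x 1
    (fun x => k%:~R^-1 * cos (- (k%:~R * x))) (sin (- (k%:~R * x))).
  have := @is_derive1_comp R (@cos R) _ x _ _ (is_derive_cos _) (lin x).
  move=> /(is_deriveZ (k%:~R^-1)).
  by move=> /is_derive_eq; apply; rewrite /GRing.scale /=; field.
rewrite (Rintegral_FTC cosc cosD) (Rintegral_FTC sinc sinD).
by rewrite !mulrN !opprK !cosN !sinN sin_int_pi oppr0 !mulr0 !subrr.
Qed.

Lemma toeplitz_cst (c : R) n : toeplitz (fun=> c) n = (c%:C)%:M.
Proof.
apply/matrixP => i j; rewrite !mxE fourier_coef_cst subr_eq0.
by rewrite -(inj_eq val_inj) eqz_nat; case: eqP; rewrite ?mulr1n.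
Qed.

Lemma toeplitz_form_le (f g : R -> R) n (u : 'rV[C]_n) :
  continuous f -> continuous g -> (forall x, D x -> f x <= g x) ->
  (u *m toeplitz f n *m u^t* ) 0 0 <= (u *m toeplitz g n *m u^t* ) 0 0.
Proof.
move=> fc gc fg; rewrite !toeplitz_form // lecR ler_pM2l ?invr_gt0 ?pi2_gt0 //.
have ic (h : R -> R) : continuous h ->
    continuous (fun x => h x * modulus (trig_poly u x) ^+ 2).
  by move=> hc x; apply: cvgM; [exact: hc | exact: trig_poly_sqr_cont].
apply: le_Rintegral => //; try by apply: integrable_pi; exact: ic.
by move=> x Dx; rewrite ler_wpM2r ?sqr_ge0 // fg.
Qed.

Variable f : R -> R.
Hypothesis fc : continuous f.

Let pp : - pi <= pi :> R.
Proof. by rewrite -subr_ge0 opprK -mulr2n -mulr_natl ltW // pi2_gt0. Qed.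

Lemma le_fmax x : D x -> f x <= fmax f.
Proof.
move=> Dx; apply: ub_le_sup; last by exists x.
have [c _ cM] := EVT_max pp (continuous_subspaceT fc).
by exists (f c) => _ [y Dy <-]; exact: cM.
Qed.

Lemma ge_fmin x : D x -> fmin f <= f x.
Proof.
move=> Dx; apply: ge_inf; last by exists x.
have [c _ cM] := EVT_min pp (continuous_subspaceT fc).
by exists (f c) => _ [y Dy <-]; exact: cM.
Qed.

Lemma fmin_gt0 : (forall x, 0 < f x) -> 0 < fmin f.
Proof.
move=> f0; have [c _ cM] := EVT_min pp (continuous_subspaceT fc).
apply: lt_le_trans (f0 c) _; apply: lb_le_inf.
  by exists (f pi); exists pi => //=; rewrite in_itv /= lexx pp.
by move=> _ [y Dy <-]; exact: cM.
Qed.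

Lemma fmin_le_fmax : fmin f <= fmax f.
Proof.
have Dp : D pi by rewrite /= in_itv /= lexx pp.
exact: le_trans (ge_fmin Dp) (le_fmax Dp).
Qed.

(** Monotonicity of the quadratic form in the symbol, compared with the constant
    symbols [fmin f] and [fmax f], whose Toeplitz matrices are scalar. *)
Lemma toeplitz_form_bounds n (u : 'rV[C]_n) :
  (fmin f)%:C * nrm u ^+ 2 <= (u *m toeplitz f n *m u^t* ) 0 0
    <= (fmax f)%:C * nrm u ^+ 2.
Proof.
have cst c : (u *m toeplitz (fun=> c) n *m u^t* ) 0 0 = c%:C * nrm u ^+ 2.
  by rewrite toeplitz_cst mul_mx_scalar -scalemxAl mxE sqrtCK dotmxE.
rewrite -!cst; apply/andP; split; apply: toeplitz_form_le => //;
  try by move=> x; exact: cvg_cst.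
- exact: ge_fmin.
- exact: le_fmax.
Qed.

Lemma toeplitz_spectrum n : exists (V : 'M[C]_n) (mu : 'I_n -> R),
  [/\ V \is unitarymx, (forall i, fmin f <= mu i <= fmax f) &
      toeplitz f n = udiag V (\row_i (mu i)%:C)].
Proof.
have [V [w [VU wR E]]] := hermitian_udiag (toeplitz_hermitian n fc).
have wE : w = \row_i (Re (w 0 i))%:C.
  by apply/rowP => i; rewrite mxE RRe_real.
exists V, (fun i => Re (w 0 i)); split; rewrite -?wE // => i.
have := toeplitz_form_bounds (row i V); rewrite E.
have -> : (row i V *m udiag V w *m (row i V)^t* ) 0 0 = w 0 i.
  rewrite rowE trmx_mul map_mxM /udiag !mulmxA.
  rewrite (mulmxtVK _ VU) (mulmxtVK _ VU) -rowE row_diag_mx.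
  rewrite -scalemxAl mxE trmx_delta map_delta_mx mul_delta_mx mxE.
  by rewrite !eqxx mulr1.
have -> : nrm (row i V) ^+ 2 = 1.
  by rewrite sqrtCK; have /row_unitarymxP -> := VU; rewrite eqxx.
by rewrite !mulr1 -{1 2}(RRe_real (wR i)) !lecR.
Qed.

End ToeplitzSpectrum.

(** * Circulant approximation of Toeplitz matrices *)

Section AbsoluteSums.
Variable R : realType.

Lemma summable_bound (t : int -> R) : (forall k, 0 <= t k) ->
  summable [set: int] (fun k => (t k)%:E) ->
  exists W : R, forall s : seq int, uniq s -> \sum_(k <- s) t k <= W.
Proof.
move=> t0 ts; exists (fine (\esum_(k in [set: int]) (t k)%:E)) => s us.
have fin : \esum_(k in [set: int]) (t k)%:E \is a fin_num.
  move: ts; rewrite summableE; congr (_ \is a fin_num); apply: eq_esum => k _.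
  by rewrite gee0_abs // lee_fin.
rewrite -lee_fin fineK // esum_ge //; exists [set` s].
  by split => //; exact: finite_seq.
by rewrite -fsbig_seq // -sumEFin.
Qed.

(** Take a finite set whose sum is within [e] of the supremum of all finite sums:
    a finite set of integers of larger moduli contributes at most [e]. *)
Lemma tail_of_bound (t : int -> R) (W e : R) : 0 < e ->
  (forall s : seq int, uniq s -> \sum_(k <- s) t k <= W) ->
  exists m : nat, forall s : seq int, uniq s ->
    all (fun k : int => (m < `|k|)%N) s -> \sum_(k <- s) t k <= e.
Proof.
move=> e0 tW.
pose S := [set x : R | exists2 s : seq int, uniq s & x = \sum_(k <- s) t k].
have S0 : S 0 by exists [::]; rewrite ?big_nil.
have SW : has_sup S.
  by split; [exists 0 | exists W => _ [s us ->]; exact: tW].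
have [_ [s0 us0 ->] s0e] := sup_adherent e0 SW.
exists (\max_(k <- s0) `|k|%N)%N => s us ms.
have us' : uniq (s0 ++ s).
  rewrite cat_uniq us0 us andbT; apply/hasPn => k ks; apply/negP => ks0.
  have := allP ms _ ks; rewrite ltnNge => /negP; apply.
  by apply: (leq_bigmax_seq (F := fun k : int => `|k|%N)).
have : \sum_(k <- s0 ++ s) t k <= sup S.
  by apply: (sup_ubound SW.2); exists (s0 ++ s).
by rewrite big_cat /=; lra.
Qed.

End AbsoluteSums.

Section DiagonalRank.
Variable F : fieldType.

Lemma rank_diag_le n (w : 'rV[F]_n) (S : {set 'I_n}) :
  (forall i, i \notin S -> w 0 i = 0) -> (\rank (diag_mx w) <= #|S|)%N.
Proof.
move=> wS; pose W := \matrix_(i < #|S|) delta_mx 0 (enum_val i) : 'M[F]_(_, n).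
suff -> : diag_mx w = diag_mx w *m W^T *m W.
  by apply: leq_trans (mxrankM_maxr _ _) (rank_leq_row _).
rewrite -mulmxA; apply/matrixP => i j; rewrite mul_diag_mx !mxE.
have -> : \sum_k W^T i k * W k j =
    \sum_(k < #|S|) ((i == enum_val k) && (j == enum_val k))%:R.
  apply: eq_bigr => k _; rewrite !mxE !eqxx /=.
  by rewrite -natrM mulnb.
rewrite -(big_enum_val (fun x => ((i == x) && (j == x))%:R)).
have [iS|iS] := boolP (i \in S); last by rewrite wS // mul0r mul0rn.
rewrite (bigD1 i) //= big1 ?addr0 => [|k /andP[_ ki]].
  by rewrite eqxx /= eq_sym mulr_natr.
by rewrite eq_sym (negPf ki).
Qed.

End DiagonalRank.

Lemma card_window n a m (S : {set 'I_n}) :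
  (forall i, i \in S -> (a <= i < a + m)%N) -> (#|S| <= m)%N.
Proof.
move=> Sa; have -> : m = size (iota a m) by rewrite size_iota.
rewrite cardE -(size_map val).
apply: uniq_leq_size; first by rewrite map_inj_uniq ?enum_uniq //; exact: val_inj.
by move=> _ /mapP[i iS ->]; rewrite mem_iota Sa // -mem_enum.
Qed.

Section Strang.
Variable R : realType.
Local Notation C := R[i].
Variable f : R -> R.
Local Notation t := (fourier_coef f).
Local Notation U n := (fourier_mx R n).

(** Partial Fourier sums of [f], over frequencies of modulus at most [m], at the
    points [x = - 2 pi i / n]: the eigenvalues of Strang's circulant.  Frequencies are
    indexed by [s - m] for [s] ranging over an initial segment. *)
Definition grid_sum (m n : nat) : 'rV[C]_n :=
  \row_i \sum_(s < (m + m).+1)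
    t (s%:Z - m%:Z) * expi (- (2 * pi * (i%:R * (s%:Z - m%:Z)%:~R) / n%:R)).

Definition toeplitz_tail (m n : nat) : 'M[C]_n :=
  \matrix_(j, l) if (m < `|j%:Z - l%:Z|)%N then t (j%:Z - l%:Z) else 0.

(** For a row [j] at distance at least [m] from both ends, the shifted index
    [j + m - s] stays in range: no wrap-around occurs, and the entry of the
    circulant is read off from the orthonormality of the columns of the Fourier
    matrix. *)
Lemma strang_entry m n (j l : 'I_n) : (m <= j)%N -> (j + m < n)%N ->
  toeplitz f n j l - circulant_of (grid_sum m n) j l = toeplitz_tail m n j l.
Proof.
move=> mj jm.
have pP (s : 'I_(m + m).+1) : (j + m - s < n)%N by rewrite (leq_ltn_trans _ jm) // leq_subr.
have -> : circulant_of (grid_sum m n) j l =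
    \sum_(s < (m + m).+1) t (s%:Z - m%:Z) * (Ordinal (pP s) == l)%:R.
  rewrite -[circulant_of _]/(udiag (U n) _) udiagE.
  under eq_bigr do rewrite mxE mulr_suml.
  rewrite exchange_big /=; apply: eq_bigr => s _.
  have <- : \sum_i Num.conj (U n i (Ordinal (pP s))) * U n i l =
      (Ordinal (pP s) == l)%:R.
    have /matrixP /(_ (Ordinal (pP s)) l) := mulmx_fourierC R n.
    rewrite [RHS]mxE => <-; rewrite mxE; apply: eq_bigr => i _; congr (_ * _).
    by rewrite [in RHS]mxE; congr (Num.conj _); rewrite [in RHS]mxE.
  rewrite mulr_sumr; apply: eq_bigr => i _.
  rewrite -(mulrA (t _)); congr (_ * _); rewrite mulrA; congr (_ * _).
  rewrite !mxE !rmorphM /= !conj_expi mulrCA; congr (_ * _).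
  rewrite -expiD !opprK; congr expi.
  rewrite -mulNr -mulrDl; congr (_ / _).
  rewrite -mulrN -mulrDr; congr (_ * _).
  have sj : (s <= j + m)%N.
    by rewrite (leq_trans _ (leq_add mj (leqnn m))) // -ltnS ltn_ord.
  by rewrite intrB natrB // natrD -!pmulrn; ring.
rewrite !mxE; case: ltnP => jl.
  rewrite big1 ?subr0 // => s _.
  have -> : (Ordinal (pP s) == l) = false; last by rewrite mulr0.
  apply/negP => /eqP/(congr1 val) /= E.
  by have := ltn_ord s; lia.
have sP : (absz (j%:Z - l%:Z + m%:Z)%R < (m + m).+1)%N by lia.
rewrite (bigD1 (Ordinal sP)) //= big1 ?addr0 => [|s sn].
  have -> : (Ordinal (pP (Ordinal sP)) == l) = true.
    by apply/eqP/val_inj => /=; lia.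
  have -> : (absz (j%:Z - l%:Z + m%:Z) : int) - m%:Z = j%:Z - l%:Z by lia.
  by rewrite mulr1 subrr.
have -> : (Ordinal (pP s) == l) = false; last by rewrite mulr0.
apply/negP => /eqP/(congr1 val) /= E; move: sn => /negP; apply.
by apply/eqP/val_inj => /=; have := ltn_ord s; lia.
Qed.

End Strang.

Section StrangApproximation.
Variable R : realType.
Local Notation C := R[i].
Variable f : R -> R.
Local Notation t := (fourier_coef f).
Local Notation U n := (fourier_mx R n).

Lemma normr_expi (x : R) : `|expi x| = 1 :> C.
Proof. by rewrite normc_def /= cos2Dsin2 sqrtr1. Qed.

Variable W : R.
Hypothesis tW : forall s : seq int, uniq s -> \sum_(k <- s) modulus (t k) <= W.

Lemma grid_sum_le m n i : `|grid_sum f m n 0 i| <= W%:C.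
Proof.
rewrite mxE; apply: le_trans (ler_norm_sum _ _ _) _.
have us : uniq [seq (s : nat)%:Z - m%:Z | s : 'I_(m + m).+1].
  rewrite map_inj_uniq ?enum_uniq // => a b /addIr [] E.
  exact: val_inj.
rewrite (le_trans _ (_ : (\sum_(k <- [seq (s : nat)%:Z - m%:Z |
  s : 'I_(m + m).+1]) modulus (t k))%:C <= _)) ?lecR ?tW //.
rewrite big_map big_enum rmorph_sum /=; apply: ler_sum => s _.
by rewrite normrM normr_expi mulr1 modulusE.
Qed.

Lemma opbound_toeplitz_tail m n e : 0 <= e ->
  (forall s : seq int, uniq s -> all (fun k : int => (m < `|k|)%N) s ->
     \sum_(k <- s) modulus (t k) <= e) ->
  opbound (toeplitz_tail f m n) e%:C.
Proof.
move=> e0 te.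
(* Along a row or a column the frequencies [j - l] are pairwise distinct. *)
have bnd (g : 'I_n -> int) : injective g ->
    \sum_j `|if (m < `|g j|)%N then t (g j) else 0| <= e%:C.
  move=> gI; pose s := [seq k <- [seq g j | j : 'I_n] | (m < `|k|)%N].
  have us : uniq s by rewrite filter_uniq // map_inj_uniq ?enum_uniq.
  have sm : all (fun k : int => (m < `|k|)%N) s by exact: filter_all.
  have := te s us sm; rewrite -lecR; apply: le_trans.
  rewrite big_filter big_map big_enum_cond /= rmorph_sum /= [leRHS]big_mkcond /=.
  apply: ler_sum => j _; case: ifP => _; first by rewrite modulusE.
  by rewrite normr0.
apply: opbound_schur => [|j|l]; first by rewrite ler0c.
  under eq_bigr do rewrite mxE.
  by apply: (bnd (fun l : 'I_n => j%:Z - l%:Z)) => a b /addrI/oppr_inj[/val_inj].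
under eq_bigr do rewrite mxE.
by apply: (bnd (fun j : 'I_n => j%:Z - l%:Z)) => a b /addIr[/val_inj].
Qed.

Definition corner m n : {set 'I_n} := [set i : 'I_n | (i < m)%N || (n <= i + m)%N].

Definition corner_mx m n : 'M[C]_n := diag_mx (\row_i (i \in corner m n)%:R).

Lemma card_corner m n : (#|corner m n| <= m + m)%N.
Proof.
have -> : corner m n = [set i : 'I_n | (i < m)%N] :|: [set i : 'I_n | (n <= i + m)%N].
  by apply/setP => i; rewrite !inE.
apply: leq_trans (leq_card_setU _ _) _.
apply: leq_add; first by apply: (@card_window _ 0) => i; rewrite inE.
apply: (@card_window _ (n - m)) => i; rewrite inE; have := ltn_ord i; lia.
Qed.

Lemma rank_corner_mx m n : (\rank (corner_mx m n) <= m + m)%N.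
Proof.
apply: leq_trans (card_corner m n); apply: rank_diag_le => i iS.
by rewrite mxE (negPf iS).
Qed.

Lemma strang_split m n :
  toeplitz f n - circulant_of (grid_sum f m n) =
  corner_mx m n *m (toeplitz f n - circulant_of (grid_sum f m n)) +
  (1%:M - corner_mx m n) *m toeplitz_tail f m n.
Proof.
have cE (Y : 'M[C]_n) i j :
    (corner_mx m n *m Y) i j = (i \in corner m n)%:R * Y i j.
  by rewrite mul_diag_mx !mxE.
have DE (X Y Z : 'M[C]_n) i j : (X + (Y - Z)) i j = X i j + (Y i j - Z i j).
  by rewrite !mxE.
rewrite mulmxBl mul1mx; apply/matrixP => i j; rewrite DE !cE.
have [iS|iS] := boolP (i \in corner m n); first by rewrite !mul1r subrr addr0.
rewrite !mul0r subr0 add0r -strang_entry; first by rewrite !mxE.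
  by move: iS; rewrite inE negb_or -leqNgt => /andP[].
by move: iS; rewrite inE negb_or -!ltnNge => /andP[].
Qed.

(** All entries of the Fourier matrix have squared modulus [1 / n], and a row is
    restricted to at most [2 m] coordinates. *)
Lemma nrm_fourier_corner m n (i : 'I_n) :
  nrm (row i (U n) *m corner_mx m n) ^+ 2 <= ((m + m)%:R / n%:R : C).
Proof.
have n0 : (0 < n)%N by case: (n) i => [[]|].
rewrite sqr_nrm mul_mx_diag.
have entry j : `|U n i j| ^+ 2 = n%:R^-1.
  rewrite mxE normrM normr_expi mulr1 normC_real -rmorphXn /=.
  rewrite real_normK ?num_real // exprVn sqr_sqrtr ?ler0n //.
  by rewrite fmorphV rmorph_nat.
rewrite (eq_bigr (fun j => (j \in corner m n)%:R * n%:R^-1)); last first.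
  move=> j _; rewrite !mxE; case: (j \in _); last by rewrite mulr0 normr0 expr0n mul0r.
  by rewrite mulr1 mul1r -(entry j) mxE.
rewrite -mulr_suml ler_wpM2r ?invr_ge0 ?ler0n // -natr_sum ler_nat.
apply: leq_trans (card_corner m n); rewrite -sum1_card [leqRHS]big_mkcond /=.
by apply: leq_sum => j _; case: (j \in _).
Qed.

End StrangApproximation.

(** * Frobenius and spectral norms, and the superoptimal circulant *)

Section Frobenius.
Variable R : realType.
Local Notation C := R[i].

Lemma frobenius_ge0 m n (M : 'M[C]_(m, n)) : 0 <= frobenius_norm M.
Proof. exact: sqrtr_ge0. Qed.

Lemma frobenius_sqr m n (M : 'M[C]_(m, n)) :
  (frobenius_norm M ^+ 2)%:C = \sum_i nrm (row i M) ^+ 2.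
Proof.
rewrite sqr_sqrtr; last first.
  by apply: sumr_ge0 => i _; apply: sumr_ge0 => j _; exact: sqr_ge0.
rewrite rmorph_sum; apply: eq_bigr => i _; rewrite rmorph_sum sqr_nrm.
by apply: eq_bigr => j _; rewrite rmorphXn /= modulusE mxE.
Qed.

Lemma ler_frobenius m n (M N : 'M[C]_(m, n)) :
  frobenius_norm M <= frobenius_norm N ->
  \sum_i nrm (row i M) ^+ 2 <= \sum_i nrm (row i N) ^+ 2.
Proof.
move=> MN; apply: (@le_trans _ _ (frobenius_norm M ^+ 2)%:C).
  by rewrite (frobenius_sqr M).
apply: (@le_trans _ _ (frobenius_norm N ^+ 2)%:C).
  by rewrite lecR ler_sqr ?nnegrE ?frobenius_ge0.
by rewrite (frobenius_sqr N).
Qed.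

Lemma sum_nrm_row m n (M : 'M[C]_(m, n)) :
  \sum_i nrm (row i M) ^+ 2 = \tr (M *m M^t*).
Proof.
apply: eq_bigr => i _; rewrite sqr_nrm mxE; apply: eq_bigr => j _.
by rewrite !mxE normCK.
Qed.

(** Both sides are traces of a matrix times its adjoint. *)
Lemma sum_nrm_row_unitary n (V M : 'M[C]_n) : V \is unitarymx ->
  \sum_i nrm (row i (V *m M *m V^t*)) ^+ 2 = \sum_i nrm (row i M) ^+ 2.
Proof.
move=> VU; apply: etrans (sum_nrm_row _) _.
apply: etrans _ (esym (sum_nrm_row _)).
rewrite !adjmxM trmxCK.
rewrite !mulmxA (mulmxKtV _ VU erefl) mxtrace_mulC !mulmxA.
by rewrite (mulmx1C (unitarymxP VU)) mul1mx.
Qed.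

Lemma frobenius_col n (x : 'cV[C]_n) : (frobenius_norm x)%:C = nrm (x^t*).
Proof.
have F0 : 0 <= (frobenius_norm x)%:C by rewrite ler0c frobenius_ge0.
apply/eqP; rewrite -(@eqrXn2 _ 2 _ _ isT F0 (nrm_ge0 _)); apply/eqP.
rewrite -rmorphXn /= frobenius_sqr sqr_nrm; apply: eq_bigr => i _.
by rewrite sqr_nrm big_ord1 !mxE norm_conjC.
Qed.

(** The bound on the adjoint, transported to columns by [(M x)^* = x^* M^*], makes
    the values of [M] on the unit ball bounded, so that their supremum dominates
    each of them. *)
Lemma spectral_norm_ge n (M : 'M[C]_n) c (x : 'cV[C]_n) : 0 <= c ->
  opbound (M^t*) c -> frobenius_norm x <= 1 ->
  frobenius_norm (M *m x) <= spectral_norm M.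
Proof.
move=> c0 Mc x1; apply: ub_le_sup; last by exists x.
exists (complex.Re c) => _ [y /= y1 <-]; rewrite -lecR.
rewrite (RRe_real (ger0_real c0)) frobenius_col adjmxM.
apply: le_trans (Mc _) _; rewrite -frobenius_col -[leRHS]mulr1.
by rewrite ler_wpM2l // (lecR _ 1).
Qed.

End Frobenius.

(** Evaluate on the unit column [(row i V)^t*], an eigenvector for [w 0 i]. *)
Lemma le_spectral_norm_udiag (R : realType) n (V : 'M[R[i]]_n) (w : 'rV[R[i]]_n)
  (i : 'I_n) : V \is unitarymx -> `|w 0 i| <= (spectral_norm (udiag V w))%:C.
Proof.
move=> VU; pose x : 'cV[R[i]]_n := (row i V)^t*.
have xV : nrm (row i V) = 1.
  by rewrite /nrm; have /row_unitarymxP -> := VU; rewrite eqxx sqrtC1.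
have x1 : frobenius_norm x <= 1.
  by rewrite -lecR frobenius_col trmxCK xV.
have c0 : 0 <= \sum_j `|w 0 j| by apply: sumr_ge0.
have Mc : opbound ((udiag V w)^t* ) (\sum_j `|w 0 j|).
  rewrite udiag_adj; apply: opbound_udiag => // j.
  by rewrite mxE norm_conjC (bigD1 j) //= lerDl sumr_ge0.
have := spectral_norm_ge c0 Mc x1; rewrite -lecR; apply: le_trans.
rewrite frobenius_col adjmxM trmxCK udiag_adj row_udiag // nrmZ xV mulr1.
by rewrite mxE norm_conjC.
Qed.

Section SuperoptimalEigenvalues.
Variable R : realType.
Local Notation C := R[i].
Local Notation U n := (fourier_mx R n).

Lemma complete_square (v b q : C) : 0 < b -> 0 < q ->
  `|1 - v * b| ^+ 2 + `|v| ^+ 2 * (q - b ^+ 2) =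
  1 - b ^+ 2 / q + q * `|v - b / q| ^+ 2.
Proof.
move=> b0 q0; have bc : Num.conj b = b by apply/CrealP/gtr0_real.
have qc : Num.conj q = q by apply/CrealP/gtr0_real.
rewrite !normCK !rmorphB !rmorphM /= fmorphV rmorph1 /=. rewrite bc qc.
by field; rewrite gt_eqF.
Qed.

(** The residual of one row is a quadratic function of the scalar [v], minimal
    at [b 0 i / q]. *)
Lemma nrm_residual_row n (b : 'rV[C]_n) (i : 'I_n) (v : C) : 0 < b 0 i ->
  let q := nrm b ^+ 2 in
  nrm (delta_mx 0 i - v *: b) ^+ 2 =
  1 - b 0 i ^+ 2 / q + q * `|v - b 0 i / q| ^+ 2.
Proof.
move=> b0 q; have q0 : 0 < q.
  rewrite exprn_gt0 // nrm_gt0; apply: contraTneq b0 => ->.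
  by rewrite mxE ltxx.
have qE : q - b 0 i ^+ 2 = \sum_(j | j != i) `|b 0 j| ^+ 2.
  by rewrite /q sqr_nrm (bigD1 i) //= ger0_norm ?(ltW b0) //; ring.
rewrite -(complete_square v b0 q0) qE sqr_nrm (bigD1 i) //= !mxE !eqxx.
congr (_ + _); rewrite mulr_sumr.
apply: eq_bigr => j ji; rewrite !mxE (negPf ji) andbF sub0r normrN normrM.
by rewrite exprMn.
Qed.

(** In the basis of the Fourier matrix the squared loss of the circulant whose
    inverse has eigenvalues [v] is a constant plus the weighted squared distance
    from [v] to the point of coordinates [B i i / q i].  This point has no zero
    coordinate, so it comes from a nonsingular circulant and is the only
    minimizer. *)
Lemma superoptimal_diag n (A T : 'M[C]_n) :
  let B := U n *m A *m (U n)^t* in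
  (forall i, 0 < B i i) -> superoptimal A T ->
  T = circulant_of (\row_i (nrm (row i B) ^+ 2 / B i i)).
Proof.
move=> B B0 [[w ->] wU Tmin].
have UU := fourier_mx_unitary R n.
have w0 := udiag_unitP UU wU.
pose q i := nrm (row i B) ^+ 2.
have Bi i : row i B 0 i = B i i by rewrite mxE.
have q0 i : 0 < q i.
  rewrite exprn_gt0 // nrm_gt0; apply: contraTneq (B0 i) => E.
  by rewrite -Bi E mxE ltxx.
pose loss (v : 'rV[C]_n) :=
  \sum_i nrm (row i (1%:M - circulant_of v *m A)) ^+ 2.
pose dist (v : 'rV[C]_n) := \sum_i q i * `|v 0 i - B i i / q i| ^+ 2.
have lossE v : loss v = \sum_i (1 - B i i ^+ 2 / q i) + dist v.
  apply: etrans (esym (sum_nrm_row_unitary _ UU)) _.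
  rewrite /dist -big_split; apply: eq_bigr => i _.
  have E : nrm (delta_mx 0 i - v 0 i *: row i B) ^+ 2 =
      1 - B i i ^+ 2 / q i + q i * `|v 0 i - B i i / q i| ^+ 2.
    by have := nrm_residual_row (v 0 i) (i := i) (b := row i B); rewrite Bi; apply.
  apply: etrans _ E; congr (nrm _ ^+ 2).
  have -> : U n *m (1%:M - circulant_of v *m A) *m (U n)^t* =
            1%:M - diag_mx v *m B.
    rewrite mulmxBr mulmxBl mulmx1 (unitarymxP UU); congr (_ - _).
    by rewrite /circulant_of !mulmxA (unitarymxP UU) mul1mx.
  rewrite linearB /= row1 row_mul row_diag_mx -scalemxAl -rowE //.
have invE (v : 'rV[C]_n) : (forall i, v 0 i != 0) ->
    circulant_of v \in unitmx /\
    invmx (circulant_of v) = circulant_of (map_mx GRing.inv v).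
  exact: udiag_inv.
pose s : 'rV[C]_n := \row_i (q i / B i i).
have s0 i : s 0 i != 0 by rewrite mxE mulf_neq0 ?invr_eq0 ?gt_eqF.
have [sU sI] := invE _ s0; have [_ wI] := invE _ w0.
have : loss (map_mx GRing.inv w) <= loss (map_mx GRing.inv s).
  have := Tmin (circulant_of s) (ex_intro _ s erefl) sU.
  by rewrite sI wI; exact: ler_frobenius.
rewrite !lossE lerD2l.
have -> : dist (map_mx GRing.inv s) = 0.
  by rewrite /dist big1 // => i _; rewrite !mxE invf_div subrr normr0 expr0n /= mulr0.
rewrite /dist => le0.
congr circulant_of; apply/rowP => i; rewrite [RHS]mxE -/(q i).
have t0 j : 0 <= q j * `|(map_mx GRing.inv w) 0 j - B j j / q j| ^+ 2.
  by apply: mulr_ge0; [exact: ltW (q0 j) | exact: exprn_ge0].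
have : q i * `|(map_mx GRing.inv w) 0 i - B i i / q i| ^+ 2 == 0.
  rewrite eq_le t0 andbT (le_trans _ le0) // (bigD1 i) //= lerDl.
  by apply: sumr_ge0.
rewrite mulf_eq0 (gt_eqF (q0 i)) expf_eq0 /= normr_eq0 subr_eq0 mxE.
by move=> /eqP E; rewrite -[LHS]invrK E invf_div.
Qed.

End SuperoptimalEigenvalues.

(** * Toeplitz matrices against their superoptimal circulants *)

Section Rayleigh.
Variable C : numClosedFieldType.

Lemma udiag_form n (V : 'M[C]_n) (w : 'rV[C]_n) (x : 'rV[C]_n) :
  (x *m udiag V w *m x^t* ) 0 0 = \sum_j w 0 j * `|(x *m V^t* ) 0 j| ^+ 2.
Proof.
have -> : x *m udiag V w *m x^t* =
    (x *m V^t* ) *m diag_mx w *m (x *m V^t* )^t*.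
  by rewrite adjmxM trmxCK /udiag !mulmxA.
move: (x *m V^t* ) => y; rewrite mxE; apply: eq_bigr => j _.
by rewrite mul_mx_diag !mxE normCK mulrAC mulrC.
Qed.

(** Each eigenvalue satisfies [w ^+ 2 <= c * w]. *)
Lemma udiag_row_le n (V : 'M[C]_n) (w : 'rV[C]_n) (x : 'rV[C]_n) c :
  V \is unitarymx -> (forall j, 0 <= w 0 j <= c) ->
  nrm (x *m udiag V w) ^+ 2 <= c * (x *m udiag V w *m x^t* ) 0 0.
Proof.
move=> VU wc; rewrite udiag_form {1}/udiag !mulmxA nrm_unitary //.
rewrite sqr_nrm mulr_sumr; apply: ler_sum => j _.
have /andP[w0 wjc] := wc j.
rewrite mul_mx_diag mxE normrM exprMn mulrC (ger0_norm w0) (mulrA c).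
apply: ler_wpM2r; first exact: exprn_ge0.
by rewrite expr2 ler_wpM2r.
Qed.

(** Pythagoras: the coordinate [i] and the other ones contribute separately to
    the norm. *)
Lemma off_diag_mass n (v : 'rV[C]_n) (i : 'I_n) d e :
  nrm (v - d *: delta_mx 0 i) <= e ->
  `|v 0 i - d| <= e /\ nrm v ^+ 2 - `|v 0 i| ^+ 2 <= e ^+ 2.
Proof.
move=> ve; have e0 : 0 <= e by rewrite (le_trans (nrm_ge0 _) ve).
have sq : nrm (v - d *: delta_mx 0 i) ^+ 2 =
    `|v 0 i - d| ^+ 2 + (nrm v ^+ 2 - `|v 0 i| ^+ 2).
  rewrite !sqr_nrm (bigD1 i) //= [in RHS](bigD1 i) //=.
  rewrite !mxE !eqxx mulr1 [in RHS]addrAC subrr add0r; congr (_ + _).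
  by apply: eq_bigr => j ji; rewrite !mxE (negPf ji) andbF mulr0 subr0.
have mass0 : 0 <= nrm v ^+ 2 - `|v 0 i| ^+ 2.
  by rewrite subr_ge0 ler_pXn2r ?nnegrE ?nrm_ge0 // norm_le_nrm.
have : nrm (v - d *: delta_mx 0 i) ^+ 2 <= e ^+ 2.
  by rewrite ler_pXn2r ?nnegrE ?nrm_ge0.
rewrite sq => le_e; split.
  rewrite -(@ler_pXn2r _ 2) ?nnegrE //; apply: le_trans le_e.
  by rewrite lerDl.
by apply: le_trans le_e; rewrite lerDr exprn_ge0.
Qed.

End Rayleigh.

Section ToeplitzVersusSuperoptimal.
Variable R : realType.
Local Notation C := R[i].
Local Notation U n := (fourier_mx R n).
Variable f : R -> R.
Hypothesis fc : continuous f.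
Hypothesis f_gt0 : forall x, 0 < f x.
Variable W : R.
Hypothesis tW : forall s : seq int, uniq s ->
  \sum_(k <- s) modulus (fourier_coef f k) <= W.

Let fmin0 : 0 < fmin f := fmin_gt0 fc f_gt0.
Let fmax0 : 0 < fmax f := lt_le_trans fmin0 (fmin_le_fmax fc).

Lemma sum_bound_ge0 : 0 <= W.
Proof. by have := tW (s := [::]) isT; rewrite big_nil. Qed.

Lemma opbound_toeplitz n : opbound (toeplitz f n) (fmax f)%:C.
Proof.
have [V [mu [VU muP ->]]] := toeplitz_spectrum fc n.
apply: opbound_udiag => //; first by rewrite ler0c ltW.
move=> i; have /andP[m1 m2] := muP i.
by rewrite mxE normC_real lecR ger0_norm // (le_trans _ m1) // ltW.
Qed.

(** The cut [m] makes the tail smaller than [e / 2]; then [n] large makes the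
    corner rows, seen through a row of the Fourier matrix, contribute at most
    [e / 2]. *)
Lemma strang_small (e : R) : 0 < e -> exists m N : nat, forall n, (N < n)%N ->
  let X := toeplitz f n - circulant_of (grid_sum f m n) in
  lowrank_plus (m + m) e%:C X /\ forall i, nrm (row i (U n) *m X) <= e%:C.
Proof.
move=> e0; have e20 : 0 < e / 2 by rewrite divr_gt0.
have [m Hm] := tail_of_bound e20 tW.
pose K := fmax f + W.
have K0 : 0 < K by rewrite ltr_wpDr // sum_bound_ge0.
(* For [n >= x] one has [K ^+ 2 * (2 m / n) <= (e / 2) ^+ 2]. *)
pose x := (m + m)%:R * K ^+ 2 / (e / 2) ^+ 2.
have x0 : 0 <= x.
  apply: divr_ge0; last exact: sqr_ge0.
  by apply: mulr_ge0; [exact: ler0n | exact: sqr_ge0].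
exists m, (Num.bound x) => n nN X.
have n0 : (0 < n)%N by exact: leq_ltn_trans nN.
have Tb : opbound (toeplitz_tail f m n) (e / 2)%:C.
  by apply: opbound_toeplitz_tail => //; exact: ltW.
have Cb : opbound (1%:M - corner_mx R m n) 1.
  have -> : 1%:M - corner_mx R m n = diag_mx (\row_i (1 - (i \in corner m n)%:R)).
    rewrite /corner_mx -diag_const_mx -linearB; congr diag_mx.
    by apply/rowP => i; rewrite !mxE.
  apply: opbound_diag => // i; rewrite mxE.
  by case: (_ \in _); rewrite ?subrr ?subr0 ?normr0 ?normr1.
have Eb : opbound ((1%:M - corner_mx R m n) *m toeplitz_tail f m n) (e / 2)%:C.
  by rewrite -[(e / 2)%:C]mul1r; apply: opboundM => //; rewrite ler0c ltW.
have XE : X = corner_mx R m n *m X + (1%:M - corner_mx R m n) *m toeplitz_tail f m n.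
  exact: strang_split.
have Xb : opbound X K%:C.
  rewrite rmorphD /=; apply: opboundD; first exact: opbound_toeplitz.
  apply: opboundN; apply: opbound_udiag; first exact: fourier_mx_unitary.
    by rewrite ler0c sum_bound_ge0.
  by move=> i; exact: grid_sum_le.
split.
  exists (corner_mx R m n *m X), ((1%:M - corner_mx R m n) *m toeplitz_tail f m n).
  split => //; first by apply: leq_trans (mxrankM_maxl _ _) (rank_corner_mx R m n).
  by apply: opbound_le Eb; rewrite lecR; lra.
move=> i; rewrite XE mulmxDr; apply: le_trans (ler_nrmD _ _) _.
have -> : e%:C = (e / 2)%:C + (e / 2)%:C :> C by rewrite -rmorphD -splitr.
apply: lerD; last first.
  apply: le_trans (Eb _) _; rewrite -[leRHS]mulr1 ler_wpM2l ?ler0c ?(ltW e20) //.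
  rewrite /nrm; have /row_unitarymxP -> := fourier_mx_unitary R n.
  by rewrite eqxx sqrtC1.
rewrite mulmxA; apply: le_trans (Xb _) _.
have Ke : 0 <= (e / 2)%:C :> C by rewrite ler0c ltW.
rewrite -(@ler_pXn2r _ 2) ?nnegrE ?mulr_ge0 ?nrm_ge0 ?ler0c ?(ltW K0) //.
rewrite exprMn; apply: (@le_trans _ _ (K%:C ^+ 2 * ((m + m)%:R / n%:R))).
  by rewrite ler_wpM2l ?exprn_ge0 ?ler0c ?(ltW K0) // nrm_fourier_corner.
have -> : K%:C ^+ 2 * ((m + m)%:R / n%:R) = (K ^+ 2 * ((m + m)%:R / n%:R))%:C :> C.
  by rewrite rmorphM rmorphXn rmorphM fmorphV !rmorph_nat.
rewrite -rmorphXn /= lecR mulrA ler_pdivrMr ?ltr0n //.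
rewrite [leLHS]mulrC [leRHS]mulrC -ler_pdivrMr ?exprn_gt0 //.
have /ltW xN := archi_boundP x0; apply: le_trans xN _.
by rewrite ler_nat ltnW.
exact: ltW.
Qed.

Variable T : forall n : nat, 'M[C]_n.
Hypothesis T_superopt : forall n, (0 < n)%N -> superoptimal (toeplitz f n) (T n).

Let B n := U n *m toeplitz f n *m (U n)^t*.

Lemma rayleigh_entry n i :
  B n i i = (row i (U n) *m toeplitz f n *m (row i (U n))^t* ) 0 0.
Proof.
have -> : B n i i = (row i (U n) *m toeplitz f n *m (U n)^t* ) 0 i.
  by rewrite -!row_mul [RHS]mxE.
rewrite [LHS]mxE [RHS]mxE; apply: eq_bigr => k _; congr (_ * _).
by rewrite !mxE.
Qed.

Lemma rayleigh_bounds n i : (fmin f)%:C <= B n i i <= (fmax f)%:C.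
Proof.
have := toeplitz_form_bounds fc (row i (U n)); rewrite -rayleigh_entry.
have -> : nrm (row i (U n)) ^+ 2 = 1.
  by rewrite sqrtCK; have /row_unitarymxP -> := fourier_mx_unitary R n; rewrite eqxx.
by rewrite !mulr1.
Qed.

Lemma rayleigh_gt0 n i : 0 < B n i i.
Proof. by have /andP[+ _] := rayleigh_bounds i; apply: lt_le_trans; rewrite ltr0C. Qed.

Lemma row_BE n i : row i (B n) = row i (U n) *m toeplitz f n *m (U n)^t*.
Proof. by rewrite /B !row_mul. Qed.

(** The eigenvalues of the superoptimal circulant. *)
Definition lambda n : 'rV[C]_n := \row_i (nrm (row i (B n)) ^+ 2 / B n i i).

Lemma superoptE n : (0 < n)%N -> T n = circulant_of (lambda n).
Proof.
move=> n0; apply: superoptimal_diag (T_superopt n0) => i.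
exact: rayleigh_gt0.
Qed.

Lemma lambda_bounds n i : 0 <= lambda n 0 i <= (fmax f)%:C.
Proof.
have b0 := rayleigh_gt0 i; rewrite mxE divr_ge0 ?exprn_ge0 ?nrm_ge0 ?(ltW b0) //=.
rewrite ler_pdivrMr // row_BE nrm_unitary ?trmxC_unitary ?fourier_mx_unitary //.
rewrite rayleigh_entry.
have [V [mu [VU muP ->]]] := toeplitz_spectrum fc n.
apply: udiag_row_le => // j; have /andP[m1 m2] := muP j.
by rewrite mxE ler0c lecR m2 andbT (le_trans (ltW fmin0)).
Qed.

(** Row [i] of [B n] is within [e] of [d 0 i *: delta_mx 0 i].  So its diagonal
    entry is within [e] of [d 0 i], and its eigenvalue exceeds that entry by the
    squared norm of the other entries, at most [e ^+ 2], over [B n i i]. *)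
Lemma lambda_near_grid n (d : 'rV[C]_n) e :
  (forall i, nrm (row i (U n) *m (toeplitz f n - circulant_of d)) <= e) ->
  forall i, `|lambda n 0 i - d 0 i| <= e + e ^+ 2 / (fmin f)%:C.
Proof.
move=> de i; have b0 := rayleigh_gt0 i.
have : nrm (row i (B n) - d 0 i *: delta_mx 0 i) <= e.
  have -> : row i (B n) - d 0 i *: delta_mx 0 i =
      row i (U n) *m (toeplitz f n - circulant_of d) *m (U n)^t*.
    rewrite mulmxBr mulmxBl -row_BE; congr (_ - _).
    by rewrite -!row_mul circulant_ofK row_diag_mx.
  by rewrite nrm_unitary // trmxC_unitary fourier_mx_unitary.
move=> /off_diag_mass; rewrite ![row i (B n) 0 i]mxE => -[nd mass].
have -> : lambda n 0 i - d 0 i =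
    (B n i i - d 0 i) + (nrm (row i (B n)) ^+ 2 - `|B n i i| ^+ 2) / B n i i.
  by rewrite mxE ger0_norm ?(ltW b0) //; field; rewrite gt_eqF.
have e0 : 0 <= e ^+ 2 by rewrite exprn_ge0 // (le_trans _ nd).
apply: le_trans (ler_normD _ _) (lerD nd _).
have mass0 : 0 <= nrm (row i (B n)) ^+ 2 - `|B n i i| ^+ 2.
  rewrite subr_ge0 ler_pXn2r ?nnegrE ?nrm_ge0 //.
  by have := norm_le_nrm (row i (B n)) i; rewrite mxE.
rewrite ger0_norm ?divr_ge0 ?(ltW b0) //.
apply: (@le_trans _ _ (e ^+ 2 / B n i i)).
  by rewrite ler_wpM2r ?invr_ge0 ?(ltW b0).
rewrite ler_wpM2l // lef_pV2 ?posrE ?ltr0C //.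
by have /andP[] := rayleigh_bounds i.
Qed.

Lemma toeplitz_superopt_clustered :
  zero_clustered (fun n => toeplitz f n - T n).
Proof.
move=> eps eps0; have eE : eps = (complex.Re eps)%:C by rewrite RRe_real // gtr0_real.
move: eps0; rewrite eE ltr0C; set r := complex.Re eps => r0.
(* For [e <= 1] the total error [e + (e + e ^+ 2 / fmin f)] is at most [e * c]. *)
pose c := 2 + (fmin f)^-1.
have c0 : 0 < c by rewrite addr_gt0 // invr_gt0.
pose e := Num.min 1 (r / c).
have e0 : 0 < e by rewrite lt_min ltr01 divr_gt0.
have e1 : e <= 1 by rewrite ge_min lexx.
have ec : e * c <= r by rewrite -ler_pdivlMr // ge_min lexx orbT.
have [m [N H]] := strang_small e0.
exists (m + m)%N, N => n nN; have n0 : (0 < n)%N by exact: leq_ltn_trans nN.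
have [[L [E [XE Lm Ee]]] row_e] := H n nN.
exists L, (E + (circulant_of (grid_sum f m n) - T n)); split => //.
  by rewrite addrA -XE addrA subrK.
apply: (@opbound_le _ _ _ _ (e%:C + (e%:C + e%:C ^+ 2 / (fmin f)%:C))).
  have -> : e%:C + (e%:C + e%:C ^+ 2 / (fmin f)%:C) =
      (e + (e + e ^+ 2 / fmin f))%:C :> C.
    by rewrite !rmorphD rmorphM /= rmorphXn /= fmorphV.
  rewrite lecR; apply: le_trans ec.
  have -> : e * c = e + (e + e / fmin f) by rewrite /c; ring.
  rewrite !lerD2l ler_wpM2r ?invr_ge0 ?(ltW fmin0) //.
  by rewrite expr2 ler_piMl // ltW.
apply: opboundD => //; rewrite superoptE // [_ - _]udiagB.
apply: opbound_udiag; first exact: fourier_mx_unitary.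
  by rewrite addr_ge0 ?divr_ge0 ?exprn_ge0 ?ler0c ?(ltW e0) ?(ltW fmin0).
move=> i; have -> : (grid_sum f m n - lambda n) 0 i =
    grid_sum f m n 0 i - lambda n 0 i.
  by move: (grid_sum _ _ _) (lambda _) => x y; rewrite !mxE.
by rewrite distrC; exact: lambda_near_grid.
Qed.

End ToeplitzVersusSuperoptimal.

(** * Power series preserve the clustering *)

Section MatrixFunctionClustered.
Variable R : realType.
Local Notation C := R[i].
Variables (b : nat -> R) (rho : R).
Hypothesis rho_ge0 : 0 <= rho.
Hypothesis b_cvg : cvgn (series (fun k => `|b k| * rho ^+ k)).
Local Notation a := (fun k => (b k)%:C : C).

Lemma opbound_matrix_fun_tail n (V : 'M[C]_n) (mu : 'I_n -> R) K e :
  V \is unitarymx -> (forall i, `|mu i| <= rho) ->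
  (forall x, `|x| <= rho -> `|psum b x - \sum_(k < K) b k * x ^+ k| <= e) ->
  opbound (matrix_fun a (udiag V (\row_i (mu i)%:C)) -
           \sum_(k < K) a k *: udiag V (\row_i (mu i)%:C) ^+ k) e%:C.
Proof.
move=> VU mur te; rewrite (matrix_fun_udiag rho_ge0 b_cvg VU mur).
have -> : \sum_(k < K) a k *: udiag V (\row_i (mu i)%:C) ^+ k =
    udiag V (\row_i (\sum_(k < K) b k * mu i ^+ k)%:C).
  apply/matrixP => i j; rewrite summxE udiagE.
  under eq_bigr do rewrite mxE udiag_exp // udiagE mulr_sumr.
  rewrite exchange_big /=; apply: eq_bigr => l _.
  rewrite mxE rmorph_sum mulr_suml; apply: eq_bigr => k _.
  by rewrite !mxE rmorphM rmorphXn /= !mulrA.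
have e0 : 0 <= e by apply: le_trans (te 0 _); rewrite ?normr0.
rewrite udiagB; apply: opbound_udiag => //; first by rewrite ler0c.
by move=> i; rewrite !mxE -rmorphB normC_real lecR; apply: te.
Qed.

(** Partial sums of the power series are handled term by term, and approximate
    both matrix functions uniformly in [n]. *)
Lemma matrix_fun_clustered (A B : forall n, 'M[C]_n) :
  (forall n, (0 < n)%N -> exists (V : 'M[C]_n) (mu : 'I_n -> R),
     [/\ V \is unitarymx, (forall i, `|mu i| <= rho) &
         A n = udiag V (\row_i (mu i)%:C)]) ->
  (forall n, (0 < n)%N -> exists (V : 'M[C]_n) (mu : 'I_n -> R),
     [/\ V \is unitarymx, (forall i, `|mu i| <= rho) &
         B n = udiag V (\row_i (mu i)%:C)]) ->
  zero_clustered (fun n => A n - B n) ->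
  zero_clustered (fun n => matrix_fun a (A n) - matrix_fun a (B n)).
Proof.
move=> AD BD ABz.
have bnd (X : forall n, 'M[C]_n) :
    (forall n, (0 < n)%N -> exists (V : 'M[C]_n) (mu : 'I_n -> R),
     [/\ V \is unitarymx, (forall i, `|mu i| <= rho) &
         X n = udiag V (\row_i (mu i)%:C)]) ->
    forall n, (0 < n)%N -> opbound (X n) rho%:C.
  move=> XD n /XD [V [mu [VU mur ->]]]; apply: opbound_udiag; rewrite ?ler0c //.
  by move=> i; rewrite mxE normC_real lecR.
apply: zero_clustered_lim => eps eps0.
have eE : eps = (complex.Re eps)%:C by rewrite RRe_real // gtr0_real.
move: eps0; rewrite eE ltr0C; set r := complex.Re eps => r0.
have r20 : 0 < r / 2 by rewrite divr_gt0.
have [K HK] := psum_tail rho_ge0 b_cvg r20.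
exists (fun n => \sum_(k < K) a k *: (A n ^+ k - B n ^+ k)); split.
  apply: (zero_clustered_sum (X := fun k n => a k *: (A n ^+ k - B n ^+ k))) => k.
  apply: zero_clusteredZ; apply: zero_clustered_exp (bnd _ AD) (bnd _ BD) ABz.
  by rewrite ler0c.
exists 0%N => n n0; have [V [mu [VU mur AE]]] := AD n n0.
have [V' [mu' [VU' mur' BE]]] := BD n n0.
have tA := opbound_matrix_fun_tail VU mur HK; rewrite -AE in tA.
have tB := opbound_matrix_fun_tail VU' mur' HK; rewrite -BE in tB.
have -> : r%:C = (r / 2)%:C + (r / 2)%:C :> C by rewrite -rmorphD -splitr.
have sE : \sum_(k < K) a k *: (A n ^+ k - B n ^+ k) =
    \sum_(k < K) a k *: A n ^+ k - \sum_(k < K) a k *: B n ^+ k.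
  by rewrite -sumrB; apply: eq_bigr => k _; rewrite scalerBr.
have swap (x y z w : 'M[C]_n) : x - y - (z - w) = (x - z) - (y - w).
  by rewrite !opprB addrACA [in RHS]addrACA [- y - z]addrC.
rewrite sE swap; exact: opboundD tA (opboundN tB).
Qed.

End MatrixFunctionClustered.

(** * Counting the eigenvalues of the preconditioned matrix *)

Section CharPoly.
Variable F : fieldType.

Lemma char_poly_similar n (P A : 'M[F]_n) : P \in unitmx ->
  char_poly (invmx P *m A *m P) = char_poly A.
Proof.
move=> Pu; have PP : map_mx polyC (invmx P) *m map_mx polyC P = 1%:M.
  by rewrite -map_mxM mulVmx // map_mx1.
have PP' := mulmx1C PP.
rewrite /char_poly /char_poly_mx !map_mxM.
have -> : 'X%:M - map_mx polyC (invmx P) *m map_mx polyC A *m map_mx polyC P =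
    map_mx polyC (invmx P) *m ('X%:M - map_mx polyC A) *m map_mx polyC P.
  by rewrite mulmxBr mulmxBl mul_mx_scalar -scalemxAl PP scalemx1.
by rewrite !det_mulmx mulrC mulrA -det_mulmx PP' det1 mul1r.
Qed.

End CharPoly.

Section Eigenvalues.
Variable R : realType.
Local Notation C := R[i].

Lemma char_poly_udiag n (V : 'M[C]_n) (w : 'rV[C]_n) : V \is unitarymx ->
  char_poly (udiag V w) = \prod_i ('X - (w 0 i)%:P).
Proof.
move=> VU; rewrite /udiag -invmx_unitary // char_poly_similar ?unitarymx_unit //.
rewrite char_poly_trig ?diag_mx_is_trig //; apply: eq_bigr => i _.
by rewrite mxE eqxx mulr1n.
Qed.

Lemma count_eigenvalues_similar n (X Q H V : 'M[C]_n) (w : 'rV[C]_n)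
    (p : pred C) : Q \in unitmx -> X = Q *m H *m invmx Q ->
  H = udiag V w -> V \is unitarymx ->
  count p (eigenvalues X) = #|[set i | p (w 0 i)]%SET|.
Proof.
move=> Qu XE HE VU.
have : perm_eq (eigenvalues X) [seq w 0 i | i : 'I_n].
  apply: prod_XsubC_eq; rewrite -eigenvaluesP big_map big_enum /=.
  rewrite -(char_poly_udiag w VU) -HE XE -{1}(invmxK Q).
  by rewrite char_poly_similar // unitmx_inv.
move=> /permP ->; rewrite count_map -sum1_count -sum1_card big_enum_cond /=.
by apply: eq_bigl => i; rewrite inE.
Qed.

End Eigenvalues.

Lemma dist_pm1 (R : realType) (x e : R) : e < `|x - 1| -> e < `|x + 1| ->
  (`|x| <= 1 - e) || (1 + e <= `|x|).
Proof.
move=> h1 h2; apply/orP; move: h1 h2.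
case: (ger0P x) => ?; case: (ger0P (x - 1)) => ?; case: (ger0P (x + 1)) => ? ? ?;
  try (by left; lra); right; lra.
Qed.

(** With [Q] the inverse square root of the modulus, the preconditioned matrix is
    similar to the Hermitian [Q *m X *m Q], and [Q] turns [udiag U g] into a
    unitary matrix. *)
Lemma count_preconditioned (R : realType) n (U X : 'M[R[i]]_n)
    (g : 'I_n -> R) k (c eps : R) :
  let Q := udiag U (\row_i (Num.sqrt (`|g i|^-1))%:C) in
  U \is unitarymx -> (forall i, g i != 0) -> X^t* = X -> c < eps ->
  lowrank_plus k c%:C (Q *m (X - udiag U (\row_i (g i)%:C)) *m Q) ->
  (count (fun lam : R[i] =>
            ((eps < modulus (lam - 1)) && (eps < modulus (lam + 1)))%R)
     (eigenvalues (invmx (udiag U (\row_i `|g i|%:C)) *m X)) <= k + k)%N.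
Proof.
pose q i := Num.sqrt (`|g i|^-1).
move=> Q UU g0 Xh ceps Mk.
have q2 i : q i * q i = `|g i|^-1 by rewrite -expr2 sqr_sqrtr ?invr_ge0.
pose H := Q *m X *m Q.
have Hh : H^t* = H.
  have Qh : Q^t* = Q by exact: udiag_real_adj.
  by rewrite /H (adjmxM (Q *m X)) (adjmxM Q X) Xh Qh mulmxA.
have [V [w [VU wR HE]]] := hermitian_udiag Hh.
pose S := udiag U (\row_i (q i * g i * q i)%:C).
have SE : S = Q *m udiag U (\row_i (g i)%:C) *m Q.
  by rewrite /Q (udiag_realM _ _ UU) (udiag_realM _ _ UU).
have SU : S \is unitarymx.
  apply: (udiag_unitary UU) => i; rewrite mxE normC_real mulrAC q2 normrM.
  by rewrite normfV normr_id mulVf // normr_eq0 g0.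
have HSM : udiag V w = S + Q *m (X - udiag U (\row_i (g i)%:C)) *m Q.
  by rewrite -HE SE mulmxBr mulmxBl addrC subrK.
have Qu : Q \in unitmx.
  apply: (udiag_inv UU _).1 => i; rewrite mxE; have : q i != 0.
    by rewrite sqrtr_eq0 -ltNge invr_gt0 normr_gt0 g0.
  by apply: contra_neq => /complexI.
have XE : invmx (udiag U (\row_i `|g i|%:C)) *m X = Q *m H *m invmx Q.
  have QQ : Q *m Q = udiag U (\row_i (`|g i|^-1)%:C).
    rewrite (udiag_realM _ _ UU); congr udiag; apply/rowP => i.
    by rewrite !mxE q2.
  have HQ : H *m invmx Q = Q *m X := mulmxK Qu (Q *m X).
  have PQ : invmx (udiag U (\row_i `|g i|%:C)) = Q *m Q.
    have gC0 i : (\row_i `|g i|%:C : 'rV[R[i]]_n) 0 i != 0.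
      by rewrite mxE -normC_real normr_eq0; apply: contra_neq (g0 i) => /complexI.
    rewrite QQ (udiag_inv UU gC0).2; congr udiag.
    by apply/rowP => i; rewrite !mxE fmorphV.
  apply: etrans (congr1 (mulmx^~ X) PQ) _.
  by rewrite -(mulmxA Q H) HQ (mulmxA Q Q).
rewrite (count_eigenvalues_similar _ Qu XE HE VU).
have half : c%:C < eps%:C :> R[i] by rewrite ltcR.
apply: leq_trans (count_near_unitary VU SU HSM Mk half).
apply: subset_leq_card; apply/fintype.subsetP => i; rewrite !inE.
rewrite -(RRe_real (wR i)); set x := complex.Re _ => /andP[].
rewrite -(rmorphB _ x 1) -(rmorphD _ x 1) !modulus_real normC_real => h1 h2.
by rewrite -(rmorphB _ 1 eps) -(rmorphD _ 1 eps) !lecR; exact: dist_pm1.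
Qed.

Theorem corollary3p5 (R : realType) (a : nat -> R[i]) (r : \bar R)
    (f : R -> R) (T : forall n : nat, 'M[R[i]]_n)
    (a_real : forall k : nat, a k \is Num.real)
    (r_gt0 : (0 < r)%E)
    (a_radius : conv_radius a = r)
    (f_wiener : wiener f)
    (f_gt0 : forall x : R, 0 < f x)
    (f_lt_r : ((fmax f ^+ 2 / fmin f)%:E < r)%E)
    (T_superopt : forall n : nat, (0 < n)%N ->
       superoptimal (toeplitz f n) (T n))
    (hT_inv_bounded : exists c0 : R, forall n : nat, (0 < n)%N ->
       matrix_fun a (T n) \in unitmx /\
       spectral_norm (invmx (matrix_fun a (T n))) < c0) :
  forall eps : R, 0 < eps ->
    exists M N : nat, [/\ (0 < M)%N, (0 < N)%N &
      forall n : nat, (N < n)%N ->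
        (count (fun lam : R[i] =>
                  ((eps < modulus (lam - 1)) && (eps < modulus (lam + 1)))%R)
               (eigenvalues (invmx (circulant_abs (matrix_fun a (T n))) *m
                             matrix_fun a (toeplitz f n))) <= M)%N].
Proof.
move=> eps eps0; case: f_wiener => _ fc f_sum.
have [W tW] := summable_bound (fun k => modulus_ge0 (fourier_coef f k)) f_sum.
have fmin0 := fmin_gt0 fc f_gt0; have fmm := fmin_le_fmax fc.
have fmax0 : 0 < fmax f := lt_le_trans fmin0 fmm.
have rho_r : ((fmax f)%:E < conv_radius a)%E.
  rewrite a_radius; apply: le_lt_trans f_lt_r.
  by rewrite lee_fin ler_pdivlMr // expr2 ler_wpM2l // ltW.
pose b k := complex.Re (a k).
have aE : a = fun k => (b k)%:C by apply/funext => k; rewrite /b RRe_real.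
have b_cvg : cvgn (series (fun k => `|b k| * fmax f ^+ k)).
  have := cvg_series_in_radius fmax0 rho_r.
  by rewrite aE; under eq_fun do rewrite modulus_real.
have rho0 := ltW fmax0.
pose lam n i := complex.Re (lambda f n 0 i).
have lamE n : lambda f n = \row_i (lam n i)%:C.
  apply/rowP => i; rewrite [RHS]mxE RRe_real //.
  by have /andP[/ger0_real] := lambda_bounds fc f_gt0 i.
have lam_le n i : `|lam n i| <= fmax f.
  rewrite -lecR -normC_real.
  have := lambda_bounds fc f_gt0 i; rewrite lamE mxE => /andP[l0 l1].
  by rewrite ger0_norm.
have TE n : (0 < n)%N -> T n = udiag (fourier_mx R n) (\row_i (lam n i)%:C).
  by move=> n0; rewrite (superoptE fc f_gt0 T_superopt n0) lamE.
pose g n i := psum b (lam n i).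
have UU n := fourier_mx_unitary R n.
have hTE n : (0 < n)%N ->
    matrix_fun a (T n) = udiag (fourier_mx R n) (\row_i (g n i)%:C).
  by move=> n0; rewrite aE TE // (matrix_fun_udiag rho0 b_cvg (UU n) (lam_le n)).
have [c0 Hc0] := hT_inv_bounded.
have g0 n i : (0 < n)%N -> g n i != 0.
  move=> n0; have [+ _] := Hc0 n n0; rewrite hTE // => /(udiag_unitP (UU n)) /(_ i).
  by rewrite mxE; apply: contra_neq => ->.
have gC0 n : (0 < n)%N -> forall i, (\row_i (g n i)%:C : 'rV[R[i]]_n) 0 i != 0.
  by move=> n0 i; rewrite mxE; apply: contra_neq (g0 n i n0) => /complexI.
(* The numbers [(g n i)^-1] are the eigenvalues of the inverse of [h (T n)]. *)
have g_inv_le n i : (0 < n)%N -> `|g n i|^-1 <= c0.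
  move=> n0; have [_ /ltW] := Hc0 n n0; apply: le_trans.
  rewrite hTE // (udiag_inv (UU n) (gC0 n n0)).2 -lecR.
  apply: le_trans (le_spectral_norm_udiag _ i (UU n)).
  by rewrite !mxE -fmorphV normC_real normfV.
pose q n i := Num.sqrt (`|g n i|^-1).
pose Q n := udiag (fourier_mx R n) (\row_i (q n i)%:C).
have Qb n : (0 < n)%N -> opbound (Q n) (Num.sqrt c0)%:C.
  move=> n0; apply: opbound_udiag => //; first by rewrite ler0c sqrtr_ge0.
  move=> i; rewrite mxE normC_real lecR ger0_norm ?sqrtr_ge0 //.
  by apply: ler_wsqrtr; exact: g_inv_le.
have sc0 : 0 <= (Num.sqrt c0)%:C :> R[i] by rewrite ler0c sqrtr_ge0.
have hAz : zero_clustered (fun n =>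
    matrix_fun a (toeplitz f n) - matrix_fun a (T n)).
  rewrite aE; apply: (matrix_fun_clustered rho0 b_cvg).
  - move=> n _; have [V [mu [VU mur ->]]] := toeplitz_spectrum fc n.
    exists V, mu; split => // i; have /andP[m1 m2] := mur i.
    by rewrite ger0_norm // (le_trans _ m1) // ltW.
  - by move=> n n0; exists (fourier_mx R n), (lam n); split => //; exact: TE.
  - exact: (toeplitz_superopt_clustered fc f_gt0 tW T_superopt).
have e2 : 0 < (eps / 2)%:C :> R[i] by rewrite ltr0C divr_gt0.
have [k [N HN]] := zero_clusteredMr sc0 Qb (zero_clusteredMl sc0 Qb hAz) e2.
exists (k + k).+1, N.+1; split => // n nN.
have n0 : (0 < n)%N by exact: leq_ltn_trans nN.
have Mk := HN n (ltnW nN); apply: (@leq_trans (k + k)); last exact: leqnSn.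
set hA := matrix_fun a (toeplitz f n) in Mk *.
have hAh : hA^t* = hA.
  rewrite /hA aE; have [V [mu [VU mur ->]]] := toeplitz_spectrum fc n.
  rewrite (matrix_fun_udiag rho0 b_cvg VU); last first.
    move=> i; have /andP[m1 m2] := mur i.
    by rewrite ger0_norm // (le_trans _ m1) // ltW.
  exact: udiag_real_adj.
have ceps : eps / 2 < eps by lra.
have Mk' : lowrank_plus k (eps / 2)%:C
    (Q n *m (hA - udiag (fourier_mx R n) (\row_i (g n i)%:C)) *m Q n).
  by move: Mk; rewrite (hTE n n0).
have PE : circulant_abs (matrix_fun a (T n)) =
    udiag (fourier_mx R n) (\row_i `|g n i|%:C).
  rewrite (hTE n n0); apply: etrans (circulant_absE _) _; congr circulant_of.
  by apply/rowP => i; rewrite !mxE normC_real.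
rewrite PE.
exact: (count_preconditioned (UU n) (fun i => g0 n i n0) hAh ceps Mk').
Qed.
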